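(* Let $\mathbf{X}=\{X_1,\ldots,X_n\}$ be a set of random variables and suppose given a parametric Bayesian-network model for $\mathbf{X}$ (as defined in the context) satisfying global parameter independence, likelihood modularity, prior modularity, covered-arc-reversal equivalence and marginal likelihood equivalence. Let $S_c$ be any complete structure for $\mathbf{X}$, $S$ any structure for $\mathbf{X}$ with parent sets $\mathbf{Pa}_1,\dots,\mathbf{Pa}_n$, and $D=\{\mathbf{x}_1,\ldots,\mathbf{x}_m\}$ any complete random sample (no missing observations). Then $$p(D\mid S^h)=\prod_{i=1}^n\frac{p\bigl(D^{\mathbf{Pa}_i\cup\{X_i\}}\mid S_c^h\bigr)}{p\bigl(D^{\mathbf{Pa}_i}\mid S_c^h\bigr)} ,$$ where the ratios are assumed to be defined, i.e. $0<p(D^{\mathbf{Pa}_i}\mid S_c^h)<\infty$ for all $i$.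
   Context: **Structures.** A structure $S$ for $\mathbf{X}=\{X_1,\ldots,X_n\}$ is a directed acyclic graph with node set $\mathbf{X}$; $\mathbf{Pa}_i=\mathbf{Pa}_i^S$ is the set of parents of $X_i$ in $S$. $S$ represents the conditional-independence assertions that, for an ordering of $\mathbf{X}$ compatible with $S$, each variable is independent of its non-parent predecessors given its parents (together with all the assertions these imply). Two structures are independence equivalent if they represent the same assertions of conditional independence. A structure is complete if it has no missing arcs (every two nodes are joined by an arc); all complete structures are independence equivalent. An arc between two nodes is covered if those two nodes would have the same parents if the arc were removed; a covered arc reversal reverses a single covered arc. **Model.** Each $X_i$ takes values in a set equipped with a reference measure (counting measure if discrete, Lebesgue measure if continuous), and all densities are with respect to these. $\mathbf{x}=(x_1,\dots,x_n)$ denotes a value of $\mathbf{X}$ and $\mathbf{pa}_i$ a value of $\mathbf{Pa}_i$. For each structure $S$ (with hypothesis $S^h$ that the joint distribution factors according to $S$; here $S^h$ serves as an index) there are parameters $\theta_s=(\theta_1,\ldots,\theta_n)$, where $\theta_i$ ranges over a Euclidean parameter set depending only on $X_i$ and its parent set, and $\theta_s$ ranges over the product of these sets; local likelihoods $p(x_i\mid\mathbf{pa}_i,\theta_i,S^h)$, which are probability densities in $x_i$ and belong to a given family $\mathcal F$ of distributions; the joint likelihood $p(\mathbf{x}\mid\theta_s,S^h)=\prod_{i=1}^n p(x_i\mid\mathbf{pa}_i,\theta_i,S^h)$; and a prior probability density $p(\theta_s\mid S^h)$ with respect to Lebesgue measure, with marginal densities $p(\theta_i\mid S^h)$. **Marginal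 likelihoods.** For $D=\{\mathbf{x}_1,\ldots,\mathbf{x}_m\}$, $p(D\mid S^h)=\int\prod_{l=1}^m p(\mathbf{x}_l\mid\theta_s,S^h)\,p(\theta_s\mid S^h)\,d\theta_s$. For $\mathbf{Y}\subseteq\mathbf{X}$, $D^{\mathbf{Y}}$ is $D$ restricted to the observations of the variables in $\mathbf{Y}$, and $p(D^{\mathbf{Y}}\mid S_c^h)$ is the marginal of $p(D\mid S_c^h)$ obtained by summing (or integrating) over the values of all the observations $D^{\mathbf{X}\setminus\mathbf{Y}}$; in particular $p(D^{\emptyset}\mid S_c^h)=1$. **Global parameter independence.** For every structure $S$, $p(\theta_s\mid S^h)=\prod_{i=1}^n p(\theta_i\mid S^h)$. **Likelihood modularity.** $p(x_i\mid\mathbf{pa}_i,\theta_i,S^h)=p(x_i\mid\mathbf{pa}_i,\theta_i)$ for every $S$ and $i$; i.e. the local likelihood of $X_i$ depends on $S$ only through the parent set of $X_i$. **Prior modularity.** If $X_i$ has the same parents in $S_1$ and $S_2$, then $p(\theta_i\mid S_1^h)=p(\theta_i\mid S_2^h)$. **Covered-arc-reversal equivalence.** Any two structures that differ by a single covered arc reversal are distribution equivalent with respect to $\mathcal F$. Structures $S_1,S_2$ are distribution equivalent if for every $\theta_{s1}$ there is a $\theta_{s2}$ with $p(\mathbf{x}\mid\theta_{s1},S_1^h)=p(\mathbf{x}\mid\theta_{s2},S_2^h)$ for all $\mathbf{x}$, and vice versa. (Independence-equivalent structures are connected by covered arc reversals, so all independence-equivalent structures are then distribution equivalent.) **Technical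 assumptions.** The parameters $\theta_i$ are uniquely determined by the local likelihood. Hence for independence-equivalent $S_1,S_2$ there is a one-to-one mapping $\theta_{s2}=\Theta_{s2}(\theta_{s1})$ between their parameter sets with $p(\mathbf{x}\mid\Theta_{s2}(\theta_{s1}),S_2^h)=p(\mathbf{x}\mid\theta_{s1},S_1^h)$. This mapping is a valid change of variables: the Jacobian $|\partial\theta_{s1}/\partial\theta_{s2}|$ exists and is non-zero everywhere. **Marginal likelihood equivalence.** For any two independence-equivalent structures $S_1,S_2$ and all $\theta_{s1}$: $p(\mathbf{x}\mid\Theta_{s2}(\theta_{s1}),S_2^h)=p(\mathbf{x}\mid\theta_{s1},S_1^h)$, and, with $\theta_{s2}=\Theta_{s2}(\theta_{s1})$, $p(\theta_{s2}\mid S_2^h)=|\partial\theta_{s1}/\partial\theta_{s2}|\,p(\theta_{s1}\mid S_1^h)$. *)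

(* Defs.v *)
From HB Require Import structures.
From mathcomp Require Import all_boot all_order all_algebra perm.
From mathcomp Require Import all_classical all_reals all_analysis.

Set Implicit Arguments.
Unset Strict Implicit.
Unset Printing Implicit Defensive.
Import Order.TTheory GRing.Theory Num.Theory.
Import numFieldNormedType.Exports.

Local Open Scope classical_set_scope.
Local Open Scope ring_scope.

(** * Lebesgue measure on [R^n] *)

(* As for tuples in the library, 'rV[R]_n carries the sigma-algebra generated
   by its coordinates, i.e. the Borel sigma-algebra. *)
Section measurable_row.
Context {R : realType} (n : nat).

Let coors : 'I_n -> 'rV[R]_n -> R := fun i v => v ord0 i.

Let row_set0 : g_sigma_preimage coors set0.
Proof. exact: sigma_algebra0. Qed.

Let row_setC A : g_sigma_preimage coors A -> g_sigma_preimage coors (~` A).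
Proof. exact: sigma_algebraC. Qed.

Let row_bigcup (F : (set 'rV[R]_n)^nat) :
  (forall i, g_sigma_preimage coors (F i)) ->
  g_sigma_preimage coors (\bigcup_i (F i)).
Proof. exact: sigma_algebra_bigcup. Qed.

HB.instance Definition _ :=
  @isMeasurable.Build (measure_tuple_display default_measure_display)
    'rV[R]_n (g_sigma_preimage coors) row_set0 row_setC row_bigcup.

End measurable_row.

Lemma measurable_row_coord (R : realType) n (k : 'I_n) :
  measurable_fun [set: 'rV[R]_n] (fun v : 'rV[R]_n => v ord0 k).
Proof.
move=> _ Y mY; rewrite setTI; apply: sub_sigma_algebra => /=.
rewrite -bigcup_seq/=; exists k => /=; first by rewrite mem_index_enum.
by exists Y => //; rewrite setTI.
Qed.

Lemma measurable_fun_rowP d (T : measurableType d) (R : realType) n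
    (f : T -> 'rV[R]_n) :
  (forall k, measurable_fun [set: T] (fun t => f t ord0 k)) ->
  measurable_fun [set: T] f.
Proof.
move=> mf.
suff : g_sigma_preimage (fun k t => f t ord0 k) `<=` @measurable _ T.
  rewrite (g_sigma_preimage_comp (fun k (v : 'rV[R]_n) => v ord0 k) f).
  by move=> prefS _ A mA; apply: prefS; exists A.
apply: smallest_sub; first exact: sigma_algebra_measurable.
case: n => [|n] in f mf *; first by rewrite big_ord0.
by rewrite -bigcup_mkord_ord; apply: bigcup_sub => k _ A [B mB <-]; exact: mf.
Qed.

Definition row_cons (R : realType) n (p : measurableTypeR R * 'rV[R]_n) :
    'rV[R]_n.+1 :=
  \row_k (if unlift ord0 k is Some j then p.2 ord0 j else p.1).

Lemma measurable_row_cons (R : realType) n :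
  measurable_fun [set: measurableTypeR R * 'rV[R]_n] (@row_cons R n).
Proof.
apply: measurable_fun_rowP => k.
have [j ->|->] := unliftP ord0 k.
  rewrite (_ : (fun _ => _) = (fun v : 'rV[R]_n => v ord0 j) \o snd).
    exact: (measurableT_comp (@measurable_row_coord R n j)).
  by apply/funext => p; rewrite mxE liftK.
rewrite (_ : (fun _ => _) = fst); last first.
  by apply/funext => p; rewrite mxE unlift_none.
exact: measurable_fst.
Qed.

Section lebesgue_step.
Local Open Scope ereal_scope.
Context {R : realType} (n : nat).
Variable mu : {sigma_finite_measure set 'rV[R]_n -> \bar R}.

Definition lebesgue_step : set 'rV[R]_n.+1 -> \bar R :=
  pushforward (lebesgue_measure \x mu) (@row_cons R n).

Let step := measure_function_pushforward__canonical__measure_function_Measure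
  (lebesgue_measure \x mu) (@measurable_row_cons R n).

Let lebesgue_step0 : lebesgue_step set0 = 0.
Proof. exact: (measure0 step). Qed.

Let lebesgue_step_ge0 A : 0 <= lebesgue_step A.
Proof. exact: (measure_ge0 step). Qed.

Let lebesgue_step_sigma_additive : semi_sigma_additive lebesgue_step.
Proof. exact: (@measure_semi_sigma_additive _ _ _ step). Qed.

HB.instance Definition _ := isMeasure.Build _ _ _ lebesgue_step
  lebesgue_step0 lebesgue_step_ge0 lebesgue_step_sigma_additive.

Let lebesgue_step_sigma_finite : sigma_finite setT lebesgue_step.
Proof.
have /sigma_finiteP[F [FT ndF Foo]] := sigma_finiteT (@lebesgue_measure R).
have /sigma_finiteP[G [GT ndG Goo]] := sigma_finiteT mu.
have FGT : \bigcup_k (F k `*` G k) = setT.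
  rewrite -setXTT FT GT predeqE => -[x y]; split.
    by move=> [k _ []/= ? ?]; split; exists k.
  move=> [/= [k _ Fkx] [l _ Gly]]; exists (maxn k l) => //; split.
  - by move: x Fkx; exact/subsetPset/ndF/leq_maxl.
  - by move: y Gly; exact/subsetPset/ndG/leq_maxr.
pose g (v : 'rV[R]_n.+1) : measurableTypeR R * 'rV[R]_n :=
  (v ord0 ord0, \row_j v ord0 (lift ord0 j)).
have mg : measurable_fun setT g.
  apply: measurable_fun_pair; first exact: measurable_row_coord.
  apply: measurable_fun_rowP => k; rewrite (_ : (fun _ => _) =
    (fun v : 'rV[R]_n.+1 => v ord0 (lift ord0 k))).
    exact: measurable_row_coord.
  by apply/funext => v; rewrite mxE.
have consK : cancel (@row_cons R n) g.
  move=> [x v]; rewrite /g !mxE unlift_none; congr pair.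
  by apply/rowP => j; rewrite !mxE liftK.
exists (fun k => g @^-1` (F k `*` G k)).
  by rewrite -preimage_bigcup FGT preimage_setT.
move=> k; have [mF Fk] := Foo k; have [mG Gk] := Goo k; split.
  by rewrite -[X in measurable X]setTI; apply: mg => //; exact: measurableX.
rewrite /lebesgue_step /pushforward -comp_preimage (_ : g \o _ = id); last first.
  by apply/funext => p /=; rewrite consK.
by rewrite preimage_id product_measure1E// lte_mul_pinfty// ge0_fin_numE.
Qed.

HB.instance Definition _ := @Measure_isSigmaFinite.Build _ _ _ lebesgue_step
  lebesgue_step_sigma_finite.

End lebesgue_step.

(* The [n]-fold product of the Lebesgue measure of [R]; on the one-point space
   [R^0] it is the unit mass. *)
Fixpoint lebesgue_row (R : realType) (n : nat) :
    {sigma_finite_measure set 'rV[R]_n -> \bar R} :=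
  if n is n'.+1 then lebesgue_step (lebesgue_row R n')
  else \d_(0 : 'rV[R]_0).

(** * Iterated integrals *)

Section iterated_integral.
Context {R : realType} {I : eqType} {d : I -> measure_display}.
Context {T : forall i, measurableType (d i)}.
Variables (mu : forall i, {measure set T i -> \bar R}) (A : forall i, set (T i)).

(* Integrates (or sums) out of [f] the coordinates listed in [s], the
   coordinate [i] ranging over [A i]; the other coordinates are those of [x]. *)
Fixpoint iterated_integral (s : seq I) (f : (forall i, T i) -> \bar R)
    (x : forall i, T i) : \bar R :=
  if s is i :: s' then
    (\int[mu i]_(t in @A i) iterated_integral s' f (dfwith x i t))%E
  else f x.

End iterated_integral.

(** * Structures *)

Definition arc n (pa : 'I_n -> {set 'I_n}) : rel 'I_n :=
  fun j i => j \in pa i.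

Record structure n := Structure {
  parents :> {ffun 'I_n -> {set 'I_n}} ;
  parents_acyclic : forall c : seq 'I_n, cycle (arc parents) c -> c = [::] }.

Definition complete n (S : structure n) :=
  forall i j : 'I_n, i != j -> (i \in S j) || (j \in S i).

(* The arc [j -> i]. *)
Definition covered_arc n (S : structure n) (j i : 'I_n) :=
  (j \in S i) /\ S i :\ j = S j.

Definition covered_arc_reversal n (S1 S2 : structure n) :=
  exists j i : 'I_n,
    [/\ covered_arc S1 j i, S2 i = S1 i :\ j, S2 j = i |: S1 j &
        forall k, k != i -> k != j -> S2 k = S1 k].

(** * Conditional independence *)

Section conditional_independence.
Context {R : realType} {d : measure_display} {Omega : measurableType d}.
Variable P : probability Omega R.

(* [g] is a version of the conditional probability of [E] given the
   sub-sigma-algebra [G]. *)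
Definition cond_prob_version (G : set (set Omega)) (E : set Omega)
    (g : Omega -> R) :=
  [/\ forall B, measurable B -> G (g @^-1` B),
      P.-integrable setT (EFin \o g) &
      forall H, G H -> (\int[P]_(w in H) (g w)%:E)%E = P (E `&` H)].

Context {n : nat} {dv : 'I_n -> measure_display}.
Context {V : forall i, measurableType (dv i)}.
Variable X : forall i, {mfun Omega >-> V i}.

Definition sigma_of (A : {set 'I_n}) : set (set Omega) :=
  <<s \bigcup_(i in [set` A]) preimage_set_system setT (X i) measurable >>.

(* [P(X_A | X_B, X_C) = P(X_A | X_C)] almost surely. *)
Definition cond_indep (A B C : {set 'I_n}) :=
  forall E g, sigma_of A E ->
    cond_prob_version (sigma_of C) E g ->
    cond_prob_version (sigma_of (B :|: C)) E g.

(* [o i] is the rank of [i] in the ordering. *)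
Definition ordered_markov (S : structure n) (o : 'S_n) :=
  forall i, cond_indep (finset.set1 i)
    ([set j : 'I_n | (o j < o i)%N]%SET :\: S i) (S i).

End conditional_independence.

Definition compatible_ordering n (S : structure n) (o : 'S_n) :=
  forall i j : 'I_n, j \in S i -> (o j < o i)%N.

(* Implication between assertions is semantic: it is tested on all families of
   random variables, with arbitrary value spaces. *)
Definition represents (R : realType) n (S : structure n)
    (A B C : {set 'I_n}) :=
  exists2 o : 'S_n, compatible_ordering S o &
    forall (d : measure_display) (Omega : measurableType d)
      (P : probability Omega R) (dv : 'I_n -> measure_display)
      (V : forall i, measurableType (dv i))
      (X : forall i, {mfun Omega >-> V i}),
    ordered_markov P X S o -> cond_indep P X A B C.

Definition independence_equivalent (R : realType) n (S1 S2 : structure n) :=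
  forall A B C : {set 'I_n},
    A :&: B = finset.set0 -> A :&: C = finset.set0 -> B :&: C = finset.set0 ->
    represents R S1 A B C <-> represents R S2 A B C.

(** * Parametric Bayesian-network models *)

Definition counting_reference (R : realType) d (T : measurableType d)
    (mu : set T -> \bar R) :=
  [/\ countable [set: T], forall A : set T, measurable A &
      forall A, mu A = counting A].

(* [T] is, through [e], a Borel subset of some [R^k]. *)
Definition lebesgue_reference (R : realType) d (T : measurableType d)
    (mu : set T -> \bar R) :=
  exists (k : nat) (e : T -> 'rV[R]_k),
    [/\ injective e, measurable (range e),
        forall A, measurable A <-> measurable (e @` A) &
        forall A, measurable A -> mu A = lebesgue_row R k (e @` A)].

(* The product sigma-algebra. *)
Definition config_cylinders n (d : 'I_n -> measure_display)
    (V : forall i, measurableType (d i)) : set (set (forall i, V i)) :=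
  \bigcup_i preimage_set_system setT (fun x => x i) measurable.
Arguments config_cylinders {n d} V _.

(* The product of the parameter sets of the nodes; the [i]-th block of a
   parameter vector is the parameter of the node [i]. *)
Definition blocks_in (R : realType) n (pdim : 'I_n -> {set 'I_n} -> nat)
    (pset : forall i P, set 'rV[R]_(pdim i P)) (S : structure n) :
    set 'rV[R]_(\sum_i pdim i (S i)) :=
  [set theta | forall i, pset i (S i) (submxrow theta i)].
Arguments blocks_in {R n pdim} pset S theta.

Unset Implicit Arguments.

(* The values of [loc S i] and [prior S] outside the parameter sets are
   irrelevant. *)
Record bn_model (R : realType) (n : nat) := BNModel {
  vdisp : 'I_n -> measure_display ;
  val_space : forall i, measurableType (vdisp i) ;
  ref : forall i, {sigma_finite_measure set (val_space i) -> \bar R} ;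
  ref_kind : forall i, counting_reference (ref i) \/ lebesgue_reference (ref i) ;

  pdim : 'I_n -> {set 'I_n} -> nat ;
  pset : forall i P, set 'rV[R]_(pdim i P) ;
  pset_measurable : forall i P, measurable (pset i P) ;

  loc : forall (S : structure n) i,
    'rV[R]_(pdim i (S i)) -> (forall j, val_space j) -> R ;
  loc_local : forall (S : structure n) i theta (x y : forall j, val_space j),
    pset i (S i) theta ->
    x i = y i -> (forall j, j \in S i -> x j = y j) ->
    loc S i theta x = loc S i theta y ;
  loc_measurable : forall (S : structure n) i,
    measurable_fun
      (pset i (S i) `*` [set: g_sigma_algebraType (config_cylinders val_space)])
      (fun p => loc S i p.1 p.2) ;
  loc_ge0 : forall (S : structure n) i theta x,
    pset i (S i) theta -> 0 <= loc S i theta x ;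
  loc_density : forall (S : structure n) i theta x, pset i (S i) theta ->
    (\int[ref i]_t (loc S i theta (dfwith x i t))%:E)%E = 1%E ;
  family : forall (i : 'I_n) (P : {set 'I_n}),
    set ((forall j, val_space j) -> R) ;
  loc_family : forall (S : structure n) i theta,
    pset i (S i) theta -> family i (S i) (loc S i theta) ;

  prior : forall S : structure n, 'rV[R]_(\sum_i pdim i (S i)) -> R ;
  prior_measurable : forall S, measurable_fun (blocks_in pset S) (prior S) ;
  prior_ge0 : forall S theta, blocks_in pset S theta -> 0 <= prior S theta ;
  prior_density : forall S,
    (\int[lebesgue_row R _]_(theta in blocks_in pset S)
      (prior S theta)%:E)%E = 1%E }.

Set Implicit Arguments.
Arguments vdisp {R n} M i : rename.
Arguments val_space {R n} M i : rename.
Arguments ref {R n} M i : rename.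
Arguments pdim {R n} M i P : rename.
Arguments pset {R n} M i P : rename.
Arguments loc {R n} M S i theta x : rename.
Arguments family {R n} M i P : rename.
Arguments prior {R n} M S theta : rename.

Section model.
Context {R : realType} {n : nat}.
Variable M : bn_model R n.

Definition config := forall i, val_space M i.

Definition param (S : structure n) := 'rV[R]_(\sum_i pdim M i (S i)).

Definition param_set (S : structure n) : set (param S) :=
  blocks_in (pset M) S.
Arguments param_set S theta : clear implicits.

Definition likelihood (S : structure n) (theta : param S) (x : config) : R :=
  \prod_i loc M S i (submxrow theta i) x.

(* The marginal density [p(theta_i | S^h)]. *)
Definition prior_marginal (S : structure n) (i : 'I_n)
    (theta_i : 'rV[R]_(pdim M i (S i))) : \bar R :=
  iterated_integral (fun j => lebesgue_row R (pdim M j (S j)))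
    (fun j => pset M j (S j)) [seq j <- enum 'I_n | j != i]
    (fun theta => (prior M S (\mxrow_j theta j))%:E)
    (dfwith (fun j => 0 : 'rV[R]_(pdim M j (S j))) i theta_i).

(* A sample of size [m]; the cell [(l, i)] is the value of the variable [i] in
   the observation [l]. *)
Definition sample (m : nat) := forall c : 'I_m * 'I_n, val_space M c.2.

Definition observation m (D : sample m) (l : 'I_m) : config :=
  fun i => D (l, i).

Definition evidence (S : structure n) m (D : sample m) : \bar R :=
  (\int[lebesgue_row R _]_(theta in param_set S)
    ((\prod_l likelihood theta (observation D l)) * prior M S theta)%:E)%E.

(* [p(D^Y | S^h)]; it depends on [D] only through the cells of [Y]. *)
Definition evidence_on (S : structure n) (Y : {set 'I_n}) m (D : sample m) :
    \bar R :=
  iterated_integral (fun c : 'I_m * 'I_n => ref M c.2) (fun=> setT)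
    [seq c <- enum {: 'I_m * 'I_n} | c.2 \notin Y]
    (fun D' : sample m => evidence S D') D.

Definition global_parameter_independence :=
  forall (S : structure n) theta, param_set S theta ->
    (prior M S theta)%:E = (\prod_i prior_marginal (submxrow theta i))%E.

Definition likelihood_modularity :=
  exists q : forall i P, 'rV[R]_(pdim M i P) -> config -> R,
    forall (S : structure n) i theta x, pset M i (S i) theta ->
      loc M S i theta x = q i (S i) theta x.

Definition prior_modularity :=
  forall (S1 S2 : structure n) i (e : S1 i = S2 i) theta,
    pset M i (S1 i) theta ->
    prior_marginal theta =
    prior_marginal (castmx (erefl, congr1 (pdim M i) e) theta).

Definition distribution_equivalent (S1 S2 : structure n) :=
  (forall theta1, param_set S1 theta1 -> exists2 theta2, param_set S2 theta2 &
     forall x, likelihood theta1 x = likelihood theta2 x) /\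
  (forall theta2, param_set S2 theta2 -> exists2 theta1, param_set S1 theta1 &
     forall x, likelihood theta1 x = likelihood theta2 x).

Definition covered_arc_reversal_equivalence :=
  forall S1 S2 : structure n,
    covered_arc_reversal S1 S2 -> distribution_equivalent S1 S2.

Definition parameter_identifiability :=
  forall (S : structure n) i theta theta',
    pset M i (S i) theta -> pset M i (S i) theta' ->
    (forall x, loc M S i theta x = loc M S i theta' x) -> theta = theta'.

(* [Theta S1 S2] is the mapping [theta_s1 |-> theta_s2]; only its values on the
   parameter set of [S1] are meaningful. *)
Variable Theta : forall S1 S2 : structure n, param S1 -> param S2.
Arguments Theta : clear implicits.

(* [|d theta_s1 / d theta_s2|]; the Jacobian matrix is square whenever this is
   used, so that [conform_mx] is a mere cast. *)
Definition abs_jacobian (S1 S2 : structure n) (theta2 : param S2) : R :=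
  `|\det (conform_mx (0 : 'M[R]_(\sum_i pdim M i (S1 i)))
             (jacobian (Theta S2 S1) theta2))|.

Definition valid_reparametrization :=
  forall S1 S2 : structure n, independence_equivalent R S1 S2 ->
  [/\ set_bij (param_set S1) (param_set S2) (Theta S1 S2),
      forall theta1, param_set S1 theta1 -> Theta S2 S1 (Theta S1 S2 theta1) = theta1,
      forall theta1 x, param_set S1 theta1 ->
        likelihood (Theta S1 S2 theta1) x = likelihood theta1 x,
      (\sum_i pdim M i (S1 i) = \sum_i pdim M i (S2 i))%N &
      forall theta2, param_set S2 theta2 ->
        differentiable (Theta S2 S1) theta2 /\ abs_jacobian S1 theta2 != 0].

Definition marginal_likelihood_equivalence :=
  forall S1 S2 : structure n, independence_equivalent R S1 S2 ->
  forall theta1, param_set S1 theta1 ->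
    (forall x, likelihood (Theta S1 S2 theta1) x = likelihood theta1 x) /\
    prior M S2 (Theta S1 S2 theta1) =
      abs_jacobian S1 (Theta S1 S2 theta1) * prior M S1 theta1.

End model.
Arguments evidence {R n} M S {m} D.
Arguments evidence_on {R n} M S Y {m} D.

(* Main.v *)
(* By global parameter independence, likelihood modularity and prior modularity,
   p(D | S^h) is a product of node evidences
   [int prod_l p(x_il | pa_il, theta_i) p(theta_i) d theta_i] that depend only
   on the node and its parent set.  For each node [i] take the complete
   structure [S'] of a total order in which the parents of [i] in [S] come
   first, immediately followed by [i].  Integrating out the later variables,
   last one first, each local density integrates to 1, so that the evidences of
   [S'] on [Pa_i] and on [Pa_i] plus [i] are products of node evidences whose
   ratio is the node evidence of [i] in [S].  Finally [S'] and [S_c] are both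
   complete, hence independence equivalent, and have the same evidence by the
   change of variables of marginal likelihood equivalence. *)
Require Import Defs.
From HB Require Import structures.
From mathcomp Require Import all_boot all_order all_algebra perm.
From mathcomp Require Import all_classical all_reals all_analysis.
From mathcomp Require Import measurable_realfun.
From mathcomp Require Import zify ring lra.

Set Implicit Arguments.
Unset Strict Implicit.
Unset Printing Implicit Defensive.
Import Order.TTheory GRing.Theory Num.Theory.
Import numFieldNormedType.Exports.

Local Open Scope classical_set_scope.
Local Open Scope ring_scope.

(** * Iterated integrals on product spaces *)

(** The change of variables is the main obstacle. [Theta] is only known to be differentiable at each
    point of a parameter set that is merely measurable: there is no open domain and no continuous
    Jacobian. Such a domain is therefore cut into countably many measurable pieces on each of which
    the map is, up to a factor [L] close to 1, a fixed linear map. Countability comes from taking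
    the linear maps with rational entries. On a piece, volumes are compared on small dyadic cubes,
    and all the losses together cost a factor [r < 1] that is arbitrarily close to 1. Because the
    roles of the two structures can be exchanged, an inequality between evidences suffices.

    Everything integrated is nonnegative and takes values in the extended reals, so every exchange
    of integrals is Tonelli; finiteness enters only when the common product of node evidences is
    cancelled. The equality of evidences of complete structures must hold for every sample and not
    just for [D], since a marginal evidence integrates over the missing observations. *)

Definition cylinders (I : Type) (d : I -> measure_display)
    (T : forall i, measurableType (d i)) : set (set (forall i, T i)) :=
  \bigcup_i preimage_set_system setT (fun x => x i) measurable.

Arguments cylinders {I d} T _.

Notation product_space T := (g_sigma_algebraType (cylinders T)).

Lemma measurable_coord (I : Type) (d : I -> measure_display)
    (T : forall i, measurableType (d i)) (i : I) :
  measurable_fun [set: product_space T] (fun x => x i).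
Proof.
move=> _ Y mY; rewrite setTI; apply: sub_sigma_algebra.
by exists i => //; exists Y => //; rewrite setTI.
Qed.

Lemma measurable_fun_productP (I : Type) (d : I -> measure_display)
    (T : forall i, measurableType (d i)) d' (P : measurableType d')
    (f : P -> product_space T) :
  (forall i, measurable_fun setT (fun p => f p i)) -> measurable_fun setT f.
Proof.
move=> mf; apply: (@measurability _ _ P (product_space T) setT f (cylinders T)) => //.
move=> _ [_ [i _ [Y mY <-]] <-]; rewrite !setTI.
by have := mf i measurableT Y mY; rewrite setTI.
Qed.

Lemma measurable_fun_dfwith (I : eqType) (d : I -> measure_display)
    (T : forall i, measurableType (d i)) d' (P : measurableType d') (i : I)
    (a : P -> product_space T) (b : P -> T i) :
  measurable_fun setT a -> measurable_fun setT b ->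
  measurable_fun setT (fun p => @dfwith I T (a p) i (b p) : product_space T).
Proof.
move=> ma mb; apply: measurable_fun_productP => j.
have [<-|ij] := eqVneq i j.
  by under [fun _ => _]funext do rewrite dfwithin.
under [fun _ => _]funext do rewrite dfwithout//.
exact: (measurableT_comp (measurable_coord (i := j)) ma).
Qed.

Lemma emeasurable_prod d (T : measurableType d) (R : realType) (D : set T)
    (I : Type) (s : seq I) (P : pred I) (h : I -> T -> \bar R) :
  (forall i, P i -> measurable_fun D (h i)) ->
  measurable_fun D (fun x => \prod_(i <- s | P i) h i x)%E.
Proof.
move=> mh; elim: s => [|j s IH].
  by under [fun _ => _]funext do rewrite big_nil; exact: measurable_cst.
under [fun _ => _]funext do rewrite big_cons.
by case: (P j) (mh j) => // mhj; apply: emeasurable_funM => //; exact: mhj.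
Qed.

Lemma measurable_patchT d (T : measurableType d) (R : realType) (A : set T)
    (f : T -> \bar R) :
  measurable A -> measurable_fun A f -> measurable_fun setT (f \_ A).
Proof. by move=> mA mf; apply/(measurable_restrictT f mA). Qed.

Lemma measurable_section_integral d d' (P : measurableType d)
    (S : measurableType d') (R : realType)
    (mu : {sigma_finite_measure set S -> \bar R}) (A : set S)
    (f : P * S -> \bar R) :
  measurable A -> measurable_fun setT f -> (forall x, 0 <= f x)%E ->
  measurable_fun setT (fun p => \int[mu]_(t in A) f (p, t))%E.
Proof.
move=> mA mf f0.
rewrite (_ : (fun _ => _) = fubini_F mu (f \_ (setT `*` A))).
  apply: measurable_fun_fubini_tonelli_F.
    apply: measurable_patchT; first exact: measurableX.
    exact: measurable_funTS.
  by move=> x; exact: erestrict_ge0.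
apply/funext => p; rewrite /fubini_F [LHS]integral_mkcond.
by apply: eq_integral => t _; rewrite /patch in_setX in_setT.
Qed.

Lemma fubini_tonelli_in d d' (P : measurableType d)
    (S : measurableType d') (R : realType)
    (nu : {sigma_finite_measure set P -> \bar R})
    (mu : {sigma_finite_measure set S -> \bar R}) (B : set P) (A : set S)
    (f : P * S -> \bar R) :
  measurable A -> measurable B -> measurable_fun setT f ->
  (forall x, 0 <= f x)%E ->
  (\int[nu]_(p in B) \int[mu]_(t in A) f (p, t) =
   \int[mu]_(t in A) \int[nu]_(p in B) f (p, t))%E.
Proof.
move=> mA mB mf f0; have mg : measurable_fun setT (f \_ (B `*` A)).
  apply: measurable_patchT; first exact: measurableX.
  exact: measurable_funTS.
have g0 x : (0 <= (f \_ (B `*` A)) x)%E by exact: erestrict_ge0.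
transitivity (\int[nu]_x \int[mu]_y (f \_ (B `*` A)) (x, y))%E.
  rewrite [LHS]integral_mkcond; apply: eq_integral => p _.
  rewrite /patch; case: ifPn => pB.
    rewrite [LHS]integral_mkcond; apply: eq_integral => t _.
    by rewrite /patch in_setX pB.
  by rewrite integral0_eq// => t _; rewrite in_setX (negbTE pB).
rewrite (fubini_tonelli _ mg g0) [RHS]integral_mkcond.
apply: eq_integral => t _; rewrite [RHS]/patch; case: ifPn => tA.
  rewrite [RHS]integral_mkcond; apply: eq_integral => p _.
  by rewrite /patch in_setX tA andbT.
by rewrite integral0_eq// => p _; rewrite /patch in_setX (negbTE tA) andbF.
Qed.

Lemma dfwith_id (I : eqType) (T : I -> Type) (x : forall i, T i) i :
  dfwith x i (x i) = x.
Proof.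
apply: functional_extensionality_dep => j; have [<-|ij] := eqVneq i j.
  by rewrite !dfwithin.
by rewrite !dfwithout.
Qed.

Lemma dfwithC (I : eqType) (T : I -> Type) (x : forall i, T i) i j
    (t : T i) (u : T j) : i != j ->
  dfwith (dfwith x i t) j u = dfwith (dfwith x j u) i t.
Proof.
move=> ij; apply: functional_extensionality_dep => k.
have [<-|ik] := eqVneq i k.
  by rewrite dfwithin dfwithout ?dfwithin// eq_sym.
rewrite [RHS]dfwithout//; have [<-|jk] := eqVneq j k.
  by rewrite !dfwithin.
by rewrite !dfwithout.
Qed.

Section iterated_integral.
Local Open Scope ereal_scope.
Context {R : realType} {I : eqType} {d : I -> measure_display}.
Context {T : forall i, measurableType (d i)}.
Variables (mu : forall i, {sigma_finite_measure set T i -> \bar R}).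
Variable A : forall i, set (T i).
Arguments A : clear implicits.
Hypothesis mA : forall i, measurable (A i).
Implicit Types (s : seq I) (f g : (forall i, T i) -> \bar R) (x : forall i, T i).

Local Notation II := (iterated_integral mu A).

Lemma iterated_integral_ge0 s f x :
  (forall y, 0 <= f y) -> 0 <= II s f x.
Proof.
by move=> f0; elim: s x => //= i s IH x; apply: integral_ge0 => t _; exact: IH.
Qed.

Lemma iterated_integral_cat s t f x :
  II (s ++ t) f x = II s (II t f) x.
Proof. by elim: s x => //= i s IH x; apply: eq_integral => u _; exact: IH. Qed.

Lemma eq_iterated_integral s f g x :
  (forall y, (forall i, i \in s -> A i (y i)) ->
     (forall i, i \notin s -> y i = x i) -> f y = g y) ->
  II s f x = II s g x.
Proof.
elim: s x => [|i s IH] x /= fg; first exact: fg.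
apply: eq_integral => t /[!inE] tA; apply: IH => y ys yx; apply: fg.
  move=> j; rewrite inE; have [js _|js] := boolP (j \in s); first exact: ys.
  by rewrite orbF => /eqP ji; rewrite ji in js *; rewrite yx// dfwithin.
move=> j; rewrite inE negb_or => /andP[ji js].
by rewrite yx// dfwithout// eq_sym.
Qed.

(** The base point is a variable of the claim because one integration evaluates the inner integral
    at [dfwith x i t]; the induction then needs only Tonelli for one section and the measurability
    of coordinate updates. The parameter in [P] will be [theta] when integrals over parameters and
    over samples are exchanged. *)
Lemma measurable_iterated_integral_param d' (P : measurableType d') s
    (f : P * product_space T -> \bar R) :
  measurable_fun setT f -> (forall p, 0 <= f p) ->
  measurable_fun [set: P * product_space T]
    (fun p => II s (fun y => f (p.1, y)) p.2).
Proof.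
move=> mf f0; elim: s => [|i s IH] /=.
  by rewrite (_ : (fun _ => _) = f)//; apply/funext => -[].
pose F (q : (P * product_space T) * T i) :=
  II s (fun y => f (q.1.1, y)) (dfwith q.1.2 i q.2).
apply: (@measurable_section_integral _ _ _ _ _ (mu i) (A i) F) => //.
  rewrite (_ : F = (fun p : P * product_space T =>
      II s (fun y => f (p.1, y)) p.2) \o
    (fun q : (P * product_space T) * T i =>
      (q.1.1, (dfwith (q.1.2 : forall i, T i) i q.2 : product_space T))))//.
  apply: measurableT_comp => //; apply: measurable_fun_pair.
    by do 2 apply: measurableT_comp => //.
  by apply: measurable_fun_dfwith => //; exact: measurableT_comp.
by move=> q; apply: iterated_integral_ge0.
Qed.

Lemma measurable_iterated_integral s f :
  measurable_fun [set: product_space T] f -> (forall y, 0 <= f y) ->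
  measurable_fun [set: product_space T] (II s f).
Proof.
move=> mf f0; have := @measurable_iterated_integral_param _ unit s (f \o snd).
move=> /(_ (measurableT_comp mf measurable_snd) (fun=> f0 _)) mF.
exact: (measurableT_comp mF (measurable_pair1 tt)).
Qed.

Lemma iterated_integral_swap i j s f x :
  measurable_fun [set: product_space T] f -> (forall y, 0 <= f y) ->
  II [:: i, j & s] f x = II [:: j, i & s] f x.
Proof.
move=> mf f0; have [->//|ij] := eqVneq i j; rewrite /=.
pose g (p : T i * T j) := II s f (dfwith (dfwith x i p.1) j p.2).
rewrite (@fubini_tonelli_in _ _ _ _ _ (mu i) (mu j) _ _ g)//.
- by apply: eq_integral => u _; apply: eq_integral => t _; rewrite /g dfwithC.
- rewrite (_ : g = (II s f : product_space T -> _) \o (fun p : T i * T j =>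
    dfwith (dfwith x i p.1) j p.2 : product_space T))//.
  apply: measurableT_comp; first exact: measurable_iterated_integral.
  by do 2 apply: measurable_fun_dfwith => //.
- by move=> p; exact: iterated_integral_ge0.
Qed.

Lemma perm_iterated_integral s t f x : perm_eq s t ->
  measurable_fun [set: product_space T] f -> (forall y, 0 <= f y) ->
  II s f x = II t f x.
Proof.
move=> + mf f0; elim: s t x => [t x|i s IH t x st].
  by rewrite perm_sym => /perm_nilP ->.
have : i \in t by rewrite -(perm_mem st) mem_head.
move=> it; case/splitPr: it st => t1 t2.
rewrite perm_sym -[i :: t2]cat1s perm_catCA cat1s perm_cons.
rewrite perm_sym => st; transitivity (II (i :: t1 ++ t2) f x).
  by apply: eq_integral => u _; exact: IH.
elim: t1 {st} x => // j t1 IHt x.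
rewrite !cat_cons iterated_integral_swap//=.
by apply: eq_integral => u _; exact: IHt.
Qed.

Lemma iterated_integral_mulr s f g x :
  measurable_fun [set: product_space T] f ->
  (forall y, 0 <= f y) -> (forall y, 0 <= g y) ->
  (forall y, (forall i, i \notin s -> y i = x i) -> g y = g x) ->
  II s (fun y => f y * g y) x = II s f x * g x.
Proof.
move=> mf f0 g0; elim: s x => //= i s IH x gx.
rewrite -ge0_integralZr//; last first.
- by move=> t _; exact: iterated_integral_ge0.
- apply: measurable_funTS.
  rewrite (_ : (fun _ => _) = (II s f : product_space T -> _) \o
    (fun t : T i => dfwith x i t : product_space T))//.
  apply: measurableT_comp; first exact: measurable_iterated_integral.
  exact: measurable_fun_dfwith.
apply: eq_integral => t _; have gt : g (dfwith x i t) = g x.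
  apply: gx => j; rewrite inE negb_or => /andP[ji _].
  by rewrite dfwithout// eq_sym.
rewrite IH ?gt// => y yx; apply: gx => j; rewrite inE negb_or => /andP[ji js].
by rewrite yx// dfwithout// eq_sym.
Qed.

Lemma iterated_integral_prod s (b : forall i, T i -> \bar R) x : uniq s ->
  (forall i, measurable_fun setT (b i)) -> (forall i t, 0 <= b i t) ->
  II s (fun y => \prod_(i <- s) b i (y i)) x =
  \prod_(i <- s) \int[mu i]_(t in A i) b i t.
Proof.
move=> + mb b0; elim: s x => [|i s IH] x /=; first by rewrite !big_nil.
move=> /andP[is_ us]; rewrite big_cons.
have mf : measurable_fun [set: product_space T]
    (fun y : product_space T => \prod_(j <- s) b j (y j)).
  apply: emeasurable_prod => j _.
  exact: (measurableT_comp (mb j) (measurable_coord (i := j))).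
have E t : II s (fun y => \prod_(j <- i :: s) b j (y j)) (dfwith x i t) =
    \prod_(j <- s) (\int[mu j]_(u in A j) b j u) * b i t.
  transitivity (II s (fun y => (\prod_(j <- s) b j (y j)) * b i (y i))
      (dfwith x i t)).
    by apply: eq_iterated_integral => y _ _; rewrite big_cons muleC.
  rewrite (iterated_integral_mulr (g := fun y => b i (y i)))//=.
  - by rewrite IH// dfwithin.
  - by move=> y; apply: prode_ge0.
  - by move=> y yx; rewrite yx.
under eq_integral do rewrite E.
rewrite ge0_integralZl//; last 2 first.
- exact: measurable_funTS.
- by apply: prode_ge0 => j _; apply: integral_ge0.
by rewrite muleC.
Qed.

End iterated_integral.

(** * Lebesgue measure on rows, by coordinates and by blocks *)

(** Change of index along [h]: [c] turns a point on [I] into a point on [J], and an update at [i]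
    into an update at [h i]. With [h] a lift it splits off the first coordinate of a row; with [h] a
    rank function it isolates one block. *)
Lemma iterated_integral_map (R : realType) (I J : eqType)
    (d : J -> measure_display) (T : forall j, measurableType (d j))
    (mu : forall j, {measure set T j -> \bar R}) (A : forall j, set (T j))
    (h : I -> J) (c : (forall i, T (h i)) -> forall j, T j) (s : seq I)
    (f : (forall j, T j) -> \bar R) y :
  (forall y i t, c (dfwith y i t) = dfwith (c y) (h i) t) ->
  iterated_integral mu A [seq h i | i <- s] f (c y) =
  iterated_integral (T := fun i => T (h i)) (fun i => mu (h i))
    (fun i => @A (h i)) s (f \o c) y.
Proof.
move=> hc; elim: s y => //= i s IH y.
by apply: eq_integral => t _; rewrite -hc IH.
Qed.

Lemma iterated_integral_zero (R : realType) (I : eqType)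
    (d : I -> measure_display) (T : forall i, measurableType (d i))
    (mu : forall i, {measure set T i -> \bar R}) (A : forall i, set (T i))
    (s : seq I) x :
  iterated_integral mu A s (fun=> 0%E) x = 0%E.
Proof. by elim: s x => //= i s IH x; rewrite integral0_eq. Qed.

Lemma iterated_integral_restrict (R : realType) (I : eqType)
    (d : I -> measure_display) (T : forall i, measurableType (d i))
    (mu : forall i, {sigma_finite_measure set T i -> \bar R})
    (A : forall i, set (T i)) (s : seq I) (f : (forall i, T i) -> \bar R) x :
  uniq s -> (forall y i, i \in s -> ~ @A i (y i) -> f y = 0%E) ->
  iterated_integral mu (fun=> setT) s f x = iterated_integral mu A s f x.
Proof.
elim: s x => //= i s IH x /andP[is_ us] f0; rewrite [RHS]integral_mkcond.
apply: eq_integral => t _; rewrite patchE IH//; last first.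
  by move=> y j js; apply: f0; rewrite inE js orbT.
(* If [t] is outside [A], the later integrations leave coordinate [i] at [t], because [s] has no
   repetition, so the integrand vanishes identically. *)
case: ifPn => // /negP tA.
apply: etrans (iterated_integral_zero mu A s (dfwith x i t)).
apply: eq_iterated_integral => y _ yx; apply: (f0 y i); first exact: mem_head.
by rewrite yx// dfwithin => /mem_set.
Qed.

Lemma integral_lebesgue_row0 (R : realType) (f : 'rV[R]_0 -> \bar R) :
  measurable_fun setT f -> (\int[lebesgue_row R 0]_v f v)%E = f 0.
Proof. by move=> mf; rewrite integral_dirac// diracT mul1e. Qed.

Lemma integral_lebesgue_rowS (R : realType) n (f : 'rV[R]_n.+1 -> \bar R) :
  measurable_fun setT f -> (forall v, 0 <= f v)%E ->
  (\int[lebesgue_row R n.+1]_v f v =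
   \int[lebesgue_measure]_t \int[lebesgue_row R n]_v f (row_cons (t, v)))%E.
Proof.
move=> mf f0.
transitivity (\int[pushforward (lebesgue_measure \x lebesgue_row R n)
    (@row_cons R n)]_v f v)%E.
  by apply: eq_measure_integral => //; exact: measurable_row_cons.
rewrite ge0_integral_pushforward//; last exact: measurable_row_cons.
rewrite preimage_setT fubini_tonelli1//=.
by apply: measurableT_comp => //; exact: measurable_row_cons.
Qed.

Section coordinates.
Context {R : realType}.
Local Notation leb := (fun=> @lebesgue_measure R).
Local Notation coordinates N :=
  (product_space (fun _ : 'I_N => measurableTypeR R)).

Lemma measurable_row_of N :
  measurable_fun [set: coordinates N]
    (fun x : coordinates N => \row_k x k : 'rV[R]_N).
Proof.
apply: measurable_fun_rowP => k.
rewrite [X in measurable_fun _ X](_ : _ = fun x : coordinates N => x k).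
  exact: (measurable_coord (T := fun _ : 'I_N => measurableTypeR R)).
by apply/funext => x; rewrite mxE.
Qed.

Lemma integral_coordinates N (f : 'rV[R]_N -> \bar R) x :
  measurable_fun setT f -> (forall v, 0 <= f v)%E ->
  (\int[lebesgue_row R N]_v f v)%E =
  iterated_integral (T := fun _ : 'I_N => measurableTypeR R) leb (fun=> setT)
    (enum 'I_N) (fun x => f (\row_k x k)) x.
Proof.
elim: N f x => [|N IH] f x mf f0.
  rewrite integral_lebesgue_row0//.
  have -> : enum 'I_0 = [::] by apply/nilP; rewrite /nilp -cardE card_ord.
  by congr f; apply/rowP => -[].
rewrite integral_lebesgue_rowS// enum_ordSl/=; apply: eq_integral => t _.
pose c (y : 'I_N -> measurableTypeR R) k : measurableTypeR R :=
  if unlift ord0 k is Some j then y j else t.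
rewrite (IH _ (fun j => x (lift ord0 j)))//; last first.
  apply: measurableT_comp => //; apply: (measurableT_comp (@measurable_row_cons R N)).
  exact: measurable_pair1.
have -> : dfwith x ord0 t = c (fun j => x (lift ord0 j)).
  apply/funext => k; rewrite /c; case: unliftP => [j|] ->.
    by rewrite dfwithout.
  by rewrite dfwithin.
rewrite (iterated_integral_map (J := 'I_N.+1)).
  apply: eq_iterated_integral => y _ _; rewrite /=; congr f.
  by apply/rowP => k; rewrite !mxE /c/=; case: unlift => // j; rewrite mxE.
move=> y i u; apply/funext => k; rewrite /c; case: unliftP => [j|] ->.
  have [<-|ij] := eqVneq i j; first by rewrite !dfwithin.
  by rewrite !dfwithout ?liftK//; apply: contra ij => /eqP/lift_inj ->.
by rewrite dfwithout ?unlift_none.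
Qed.

Section blocks.
Variables (n : nat) (d : 'I_n -> nat).
Local Notation N := (\sum_i d i)%N.
Local Notation block := (fun i => 'rV[R]_(d i)).

Lemma measurable_mxrow :
  measurable_fun [set: product_space block]
    (fun x : product_space block => \mxrow_i x i : 'rV[R]_N).
Proof.
apply: measurable_fun_rowP => k.
rewrite [X in measurable_fun _ X](_ : _ = (fun v : 'rV[R]__ =>
    v ord0 (tagnat.sig2 k)) \o (fun x : product_space block => x (tagnat.sig1 k))).
  apply: measurableT_comp; first exact: measurable_row_coord.
  exact: (measurable_coord (T := block)).
by apply/funext => x; rewrite mxE.
Qed.

Lemma measurable_submxrow i :
  measurable_fun setT (fun v : 'rV[R]_N => submxrow v i).
Proof.
apply: measurable_fun_rowP => k.
rewrite [X in measurable_fun _ X](_ : _ =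
    fun v : 'rV[R]_N => v ord0 (tagnat.Rank i k)).
  exact: measurable_row_coord.
by apply/funext => x; rewrite mxE.
Qed.

(** Both sides unfold to iterated integrals over single real coordinates. Tonelli lets these be
    listed block after block, and the coordinates of each block are then folded back into an
    integral over its own row space. *)
Lemma integral_blocks (f : 'rV[R]_N -> \bar R) theta :
  measurable_fun setT f -> (forall v, 0 <= f v)%E ->
  (\int[lebesgue_row R N]_v f v)%E =
  iterated_integral (T := block) (fun i => lebesgue_row R (d i)) (fun=> setT)
    (enum 'I_n) (fun theta => f (\mxrow_i theta i)) theta.
Proof.
move=> mf f0; pose F (x : 'I_N -> measurableTypeR R) := f (\row_k x k).
have mF : measurable_fun [set: coordinates N] F.
  exact: measurableT_comp mf (@measurable_row_of N).
pose c (theta : forall i, 'rV[R]_(d i)) (k : 'I_N) : measurableTypeR R :=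
  (\mxrow_i theta i) ord0 k.
rewrite (integral_coordinates (c theta))//.
pose s := [seq [seq tagnat.Rank i k | k <- enum 'I_(d i)] | i <- enum 'I_n].
rewrite (@perm_iterated_integral _ _ _ _ leb _ _ _ (flatten s))//; last first.
  apply: uniq_perm; first exact: enum_uniq.
    apply: (@allpairs_uniq_dep _ _ _ (fun i k => tagnat.Rank i k)).
    - exact: enum_uniq.
    - by move=> i _; exact: enum_uniq.
    - by move=> [i k] [i' k'] _ _ /= /tagnat.rank_inj.
  move=> k; rewrite mem_enum; apply/esym/flatten_mapP; exists (tagnat.sig1 k).
    exact: mem_enum.
  by rewrite -[X in X \in _]tagnat.sig2K; apply: map_f; rewrite mem_enum.
rewrite {}/s; elim: (enum 'I_n) theta => [|i s IH] theta /=.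
  by congr f; apply/rowP => k; rewrite mxE.
rewrite iterated_integral_cat.
pose G := iterated_integral (T := fun _ : 'I_N => measurableTypeR R) leb
  (fun=> setT) (flatten [seq [seq tagnat.Rank i k | k <- enum 'I_(d i)] | i <- s]) F.
have mG : measurable_fun [set: coordinates N] G.
  by apply: (@measurable_iterated_integral _ _ _ _ leb) => // y; exact: f0.
pose H t := G (c (dfwith theta i t)).
transitivity (\int[lebesgue_row R (d i)]_t H t)%E; last first.
  by apply: eq_integral => t _; rewrite -IH.
rewrite (integral_coordinates (theta i ord0)); last 2 first.
- rewrite (_ : H = (G : coordinates N -> _) \o
    (fun t => c (dfwith theta i t) : coordinates N))//.
  apply: measurableT_comp => //; apply: measurable_fun_productP => k.
  rewrite /c; apply: (measurableT_comp (@measurable_row_coord _ _ k)).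
  rewrite (_ : (fun _ => _) = (fun x : product_space block => \mxrow_i x i) \o
    (fun t => dfwith theta i t : product_space block))//.
  apply: measurableT_comp; first exact: measurable_mxrow.
  exact: measurable_fun_dfwith.
- by move=> t; apply: iterated_integral_ge0 => y; exact: f0.
(* Only block [i] varies in [c']; the other blocks stay those of [theta], so [tagnat.Rank i] is the
   change of index to apply. *)
pose c' (y : 'I_(d i) -> measurableTypeR R) := c (dfwith theta i (\row_k y k)).
have -> : c theta = c' (theta i ord0).
  rewrite /c' (_ : \row_k _ = theta i) ?dfwith_id//.
  by apply/rowP => k; rewrite mxE.
rewrite (@iterated_integral_map R _ _ _ _ _ _ (tagnat.Rank i) c')//.
have cE z j l : c z (tagnat.Rank j l) = z j ord0 l.
  by rewrite -[in RHS](mxrowK z j) [in RHS]mxE.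
move=> y k t; apply/funext => l; rewrite -[l]tagnat.sig2K.
move: (tagnat.sig1 l) (tagnat.sig2 l) => j {}l; rewrite /c' cE.
have [eij|ij] := eqVneq i j; last first.
  rewrite !dfwithout// ?cE ?dfwithout//.
  by apply: contra ij => /eqP/tagnat.rank_inj/(congr1 tag)/= ->.
case: _ / eij l => l; rewrite dfwithin mxE.
have [<-|kl] := eqVneq k l; first by rewrite !dfwithin.
rewrite !dfwithout// ?cE ?dfwithin ?mxE//.
by rewrite -val_eqE tagnat.eq_Rank eqxx.
Qed.

End blocks.
End coordinates.

Lemma iterated_integral_fubini (R : realType) (I : eqType)
    (d : I -> measure_display) (T : forall i, measurableType (d i))
    (mu : forall i, {sigma_finite_measure set T i -> \bar R})
    (A : forall i, set (T i)) d' (P : measurableType d')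
    (nu : {sigma_finite_measure set P -> \bar R}) (B : set P) (s : seq I)
    (f : P * product_space T -> \bar R) x :
  (forall i, measurable (@A i)) -> measurable B ->
  measurable_fun setT f -> (forall p, 0 <= f p)%E ->
  iterated_integral mu A s (fun y => \int[nu]_(p in B) f (p, y))%E x =
  (\int[nu]_(p in B) iterated_integral mu A s (fun y => f (p, y)) x)%E.
Proof.
move=> mA mB mf f0; elim: s x => //= i s IH x.
under eq_integral do rewrite IH.
pose g (q : T i * P) := iterated_integral mu A s (fun y => f (q.2, y)) (dfwith x i q.1).
rewrite (@fubini_tonelli_in _ _ _ _ _ (mu i) nu _ _ g)//.
- rewrite (_ : g = (fun p : P * product_space T =>
      iterated_integral mu A s (fun y => f (p.1, y)) p.2) \o
    (fun q : T i * P => (q.2, (dfwith x i q.1 : product_space T))))//.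
  apply: measurableT_comp; first exact: measurable_iterated_integral_param.
  by apply: measurable_fun_pair => //; exact: measurable_fun_dfwith.
- by move=> q; exact: iterated_integral_ge0.
Qed.

Lemma measurable_blocks (R : realType) n (d : 'I_n -> nat)
    (A : forall i, set 'rV[R]_(d i)) :
  (forall i, measurable (@A i)) ->
  measurable [set v : 'rV[R]_(\sum_i d i) | forall i, @A i (submxrow v i)].
Proof.
move=> mA; rewrite (_ : mkset _ = \bigcap_(i in [set: 'I_n])
    ((fun v : 'rV[R]_(\sum_i d i) => submxrow v i) @^-1` @A i)).
  apply: fin_bigcap_measurable => // i _; rewrite -[X in measurable X]setTI.
  exact: (measurable_submxrow (i := i) measurableT (mA i)).
by apply/seteqP; split => v vA i; [move=> _; exact: vA|exact: vA].
Qed.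

Lemma integral_blocks_in (R : realType) n (d : 'I_n -> nat)
    (A : forall i, set 'rV[R]_(d i)) (f : 'rV[R]_(\sum_i d i) -> \bar R) theta :
  let B := [set v : 'rV[R]_(\sum_i d i) | forall i, @A i (submxrow v i)] in
  (forall i, measurable (@A i)) -> measurable_fun B f ->
  (forall v, B v -> 0 <= f v)%E ->
  (\int[lebesgue_row R _]_(v in B) f v)%E =
  iterated_integral (fun i => lebesgue_row R (d i)) A
    (enum 'I_n) (fun theta => f (\mxrow_i theta i)) theta.
Proof.
move=> B mA mf f0; have mB : measurable B by exact: measurable_blocks.
rewrite integral_mkcond (integral_blocks theta); last 2 first.
- exact: measurable_patchT.
- exact: erestrict_ge0.
rewrite (@iterated_integral_restrict _ _ _ _ (fun i => lebesgue_row R (d i)) A).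
- apply: eq_iterated_integral => y yA _; rewrite patchE mem_set// => i.
  by rewrite mxrowK; apply: yA; rewrite mem_enum.
- exact: enum_uniq.
- move=> y i _ nA; rewrite patchE memNset// => By; apply: nA.
  by have := By i; rewrite mxrowK.
Qed.

(** * Node evidences *)

Section evidence_factorization.
Local Open Scope ereal_scope.
Context {R : realType} {n : nat}.
Variable M : bn_model R n.
Implicit Types (S : structure n) (i : 'I_n) (Y : {set 'I_n}) (m : nat).

Local Notation Config := (g_sigma_algebraType (config_cylinders (val_space M))).
Local Notation Sample m := (product_space (fun c : 'I_m * 'I_n => val_space M c.2)).

(* Local likelihoods and priors are set to 0 outside the parameter sets, where
   the model does not constrain them, so as to be measurable everywhere. *)
Definition eloc S i (t : 'rV[R]_(pdim M i (S i))) (x : config M) : \bar R :=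
  if t \in Defs.pset M i (S i) then (loc M S i t x)%:E else 0.

Definition eprior S (theta : param M S) : \bar R :=
  if theta \in @param_set _ _ M S then (prior M S theta)%:E else 0.

Definition node_evidence S i m (D : sample M m) : \bar R :=
  \int[lebesgue_row R _]_(t in Defs.pset M i (S i))
    ((\prod_l eloc t (observation D l)) * prior_marginal t).

Lemma eloc_ge0 S i t x : 0 <= eloc (S := S) (i := i) t x.
Proof. by rewrite /eloc; case: ifPn => // /set_mem tA; rewrite lee_fin loc_ge0. Qed.

Lemma eprior_ge0 S theta : 0 <= eprior (S := S) theta.
Proof. by rewrite /eprior; case: ifPn => // /set_mem tA; rewrite lee_fin prior_ge0. Qed.

Lemma measurable_param_set S : measurable (@param_set _ _ M S).
Proof.
apply: (@measurable_blocks R n (fun i => pdim M i (S i))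
  (fun i => Defs.pset M i (S i))) => i.
exact: pset_measurable.
Qed.

Lemma measurable_eprior S : measurable_fun setT (eprior (S := S)).
Proof.
rewrite (_ : @eprior S = (EFin \o prior M S) \_ (@param_set _ _ M S)).
  apply: measurable_patchT; first exact: measurable_param_set.
  by apply/measurable_EFinP; exact: (prior_measurable R n M S).
by apply/funext => theta; rewrite patchE.
Qed.

Lemma measurable_eloc S i :
  measurable_fun [set: 'rV[R]_(pdim M i (S i)) * Config]
    (fun p => eloc (S := S) (i := i) p.1 p.2).
Proof.
rewrite (_ : (fun _ => _) = (fun p : 'rV[R]_(pdim M i (S i)) * Config =>
    (loc M S i p.1 p.2)%:E) \_ (Defs.pset M i (S i) `*` setT)).
  apply: measurable_patchT.
    apply: measurableX; [exact: (pset_measurable R n M)|exact: measurableT].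
  by apply/measurable_EFinP; exact: (loc_measurable R n M S i).
by apply/funext => -[t x]; rewrite patchE in_setX in_setT andbT.
Qed.

Lemma measurable_observation m l :
  measurable_fun [set: Sample m]
    (fun D : Sample m => observation D l : Config).
Proof.
apply: (measurable_fun_productP (T := val_space M)) => i.
exact: (measurable_coord (T := fun c : 'I_m * 'I_n => val_space M c.2) (i := (l, i))).
Qed.

Lemma prior_marginal_eprior S i t : Defs.pset M i (S i) t ->
  prior_marginal t =
  iterated_integral (fun j => lebesgue_row R (pdim M j (S j)))
    (fun j => Defs.pset M j (S j)) [seq j <- enum 'I_n | j != i]
    (fun theta => eprior (S := S) (\mxrow_j theta j))
    (dfwith (fun j => 0%R : 'rV[R]_(pdim M j (S j))) i t).
Proof.
move=> ti; apply: eq_iterated_integral => y yA yt.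
rewrite /eprior mem_set// => j; rewrite mxrowK.
have [->|ji] := eqVneq j i; last by apply: yA; rewrite mem_filter ji mem_enum.
by rewrite yt ?dfwithin// mem_filter eqxx.
Qed.

Let eprior_mxrow S (theta : product_space (fun j => 'rV[R]_(pdim M j (S j)))) :=
  eprior (S := S) (\mxrow_j theta j).

Let measurable_eprior_mxrow S :
  measurable_fun setT (@eprior_mxrow S).
Proof.
apply: (measurableT_comp (@measurable_eprior S)).
exact: (@measurable_mxrow R n (fun j => pdim M j (S j))).
Qed.

Lemma measurable_prior_marginal S i :
  measurable_fun (Defs.pset M i (S i)) (@prior_marginal _ _ M S i).
Proof.
pose g t := iterated_integral (fun j => lebesgue_row R (pdim M j (S j)))
    (fun j => Defs.pset M j (S j)) [seq j <- enum 'I_n | j != i]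
    (@eprior_mxrow S)
    (dfwith (fun j => 0%R : 'rV[R]_(pdim M j (S j))) i t).
apply: (eq_measurable_fun g) => [t /[!inE] ti|]; first by rewrite prior_marginal_eprior.
apply: measurable_funTS; apply: (measurableT_comp (f := iterated_integral
    (fun j => lebesgue_row R (pdim M j (S j)))
    (fun j => Defs.pset M j (S j)) [seq j <- enum 'I_n | j != i] (@eprior_mxrow S) :
    product_space (fun j => 'rV[R]_(pdim M j (S j))) -> _)).
  apply: (@measurable_iterated_integral _ _ _ _
    (fun j => lebesgue_row R (pdim M j (S j)))).
  - by move=> j; exact: pset_measurable.
  - exact: measurable_eprior_mxrow.
  - by move=> y; exact: eprior_ge0.
exact: measurable_fun_dfwith.
Qed.

Lemma prior_marginal_ge0 S i t : Defs.pset M i (S i) t -> 0 <= prior_marginal t.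
Proof.
move=> ti; rewrite prior_marginal_eprior//; apply: iterated_integral_ge0 => y.
exact: eprior_ge0.
Qed.

Lemma integral_param_set S (f : param M S -> \bar R) theta :
  measurable_fun setT f -> (forall v, 0 <= f v) ->
  \int[lebesgue_row R _]_(v in @param_set _ _ M S) f v =
  iterated_integral (fun j => lebesgue_row R (pdim M j (S j)))
    (fun j => Defs.pset M j (S j)) (enum 'I_n) (fun theta => f (\mxrow_i theta i)) theta.
Proof.
move=> mf f0; apply: integral_blocks_in => // [i|].
  exact: pset_measurable.
exact: measurable_funTS.
Qed.

(** With block [i] outermost, the remaining integrals of the joint prior are by definition its
    marginal. This is what makes the nodes outside [Y] contribute a factor 1 in the factorization
    that follows. *)
Lemma integral_prior_marginal S i :
  \int[lebesgue_row R _]_(t in Defs.pset M i (S i)) prior_marginal t = 1.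
Proof.
rewrite -(prior_density _ _ M S).
transitivity (\int[lebesgue_row R _]_(v in @param_set _ _ M S) eprior v);
  last first.
  by apply: eq_integral => v vS; rewrite /eprior vS.
rewrite (@integral_param_set _ _ (fun=> 0%R)); last 2 first.
- exact: measurable_eprior.
- exact: eprior_ge0.
rewrite (@perm_iterated_integral _ _ _ _ (fun j => lebesgue_row R (pdim M j (S j)))
   _ _ _ (i :: [seq j <- enum 'I_n | j != i]))/=.
- by apply: eq_integral => t /[!inE] ti; rewrite prior_marginal_eprior.
- by move=> j; exact: pset_measurable.
- rewrite -rem_filter ?enum_uniq// perm_to_rem// mem_enum//.
- exact: measurable_eprior_mxrow.
- by move=> y; exact: eprior_ge0.
Qed.

Hypothesis gpi : global_parameter_independence M.

(** Global independence splits the prior over all nodes while only the likelihoods of [Y] are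
    present. The integrand is a product of functions of single blocks, and a block outside [Y]
    carries its prior marginal alone, of integral 1. General [Y] is needed because marginal
    evidences keep just some of the nodes. *)
Lemma integral_factorization S Y m (D : sample M m) :
  \int[lebesgue_row R _]_(theta in @param_set _ _ M S)
    ((\prod_(i in Y) \prod_l eloc (submxrow theta i) (observation D l)) *
     eprior theta) =
  \prod_(i in Y) node_evidence S i D.
Proof.
pose a i (t : 'rV[R]_(pdim M i (S i))) :=
  if i \in Y then \prod_l eloc (S := S) t (observation D l) else 1.
have a0 i t : 0 <= a i t.
  by rewrite /a; case: ifPn => // _; apply: prode_ge0 => l _; exact: eloc_ge0.
have meloc i l : measurable_fun setT (fun t : 'rV[R]_(pdim M i (S i)) =>
    eloc (S := S) t (observation D l)).
  rewrite [X in measurable_fun _ X](_ : _ =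
    (fun p : 'rV[R]_(pdim M i (S i)) * Config => eloc (S := S) p.1 p.2) \o
    (fun t => (t, observation D l : Config)))//.
  exact: measurableT_comp (@measurable_eloc S i) (measurable_pair2 _).
have ma i : measurable_fun setT (a i).
  rewrite /a; case: (i \in Y); last exact: measurable_cst.
  by apply: emeasurable_prod => l _; exact: meloc.
pose b i := (fun t => a i t * prior_marginal t) \_ (Defs.pset M i (S i)).
have mb i : measurable_fun setT (b i).
  apply: measurable_patchT; first exact: pset_measurable.
  apply: emeasurable_funM.
    apply: measurable_funTS.
    exact: ma.
  exact: measurable_prior_marginal.
have b0 i t : 0 <= b i t.
  by apply: erestrict_ge0 => u Su; rewrite mule_ge0 ?prior_marginal_ge0.
have -> : \prod_(i in Y) node_evidence S i D =
    \prod_(i <- enum 'I_n) \int[lebesgue_row R _]_(t in Defs.pset M i (S i)) b i t.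
  rewrite big_enum big_mkcond; apply: eq_bigr => i _.
  transitivity (\int[lebesgue_row R _]_(t in Defs.pset M i (S i))
      (a i t * prior_marginal t)).
    rewrite /a; case: ifPn => // _.
    by under eq_integral do rewrite mul1e; rewrite integral_prior_marginal.
  by apply: eq_integral => t tS; rewrite /b patchE tS.
rewrite -(@iterated_integral_prod _ _ _ _ (fun j => lebesgue_row R (pdim M j (S j))) _ _
  _ _ (fun=> 0%R)) ?enum_uniq//; last by move=> i; exact: pset_measurable.
rewrite (@integral_param_set _ _ (fun=> 0%R)); last 2 first.
- apply: emeasurable_funM; last exact: measurable_eprior.
  apply: emeasurable_prod => i _; apply: emeasurable_prod => l _.
  apply: (measurableT_comp (meloc i l)).
  exact: (@measurable_submxrow R n (fun j => pdim M j (S j))).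
- move=> v; rewrite mule_ge0 ?eprior_ge0//; apply: prode_ge0 => i _.
  by apply: prode_ge0 => l _; exact: eloc_ge0.
apply: eq_iterated_integral => y yA _.
have yP : @param_set _ _ M S (\mxrow_j y j).
  by move=> j; rewrite mxrowK; apply: yA; rewrite mem_enum.
rewrite /eprior mem_set// gpi// big_enum/= [X in X * _]big_mkcond -big_split/=.
apply: eq_bigr => i _; rewrite /b patchE mem_set//; last by apply: yA; rewrite mem_enum.
by rewrite mxrowK.
Qed.

End evidence_factorization.

(** * Marginal evidences *)

(** The head of [s] is integrated last. The relation [before i j] means that [q i] is constant in
    coordinate [j], so in the induction [g] absorbs the head density [q i], which is a constant for
    all inner integrals; once these are gone, the outer integral of [q i] is 1. *)
Lemma iterated_integral_marginalize (R : realType) (I : eqType)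
    (d : I -> measure_display) (T : forall i, measurableType (d i))
    (mu : forall i, {sigma_finite_measure set T i -> \bar R})
    (q : I -> (forall i, T i) -> \bar R)
    (before : rel I) (s : seq I) (g : (forall i, T i) -> \bar R) (x : forall i, T i) :
  (forall i y, 0 <= q i y)%E ->
  (forall i y, measurable_fun setT (fun t : T i => q i (dfwith y i t))) ->
  (forall i y, i \in s -> \int[mu i]_t q i (dfwith y i t) = 1)%E ->
  (forall i j y t, before i j -> q i (dfwith y j t) = q i y) ->
  pairwise before s ->
  (forall y, 0 <= g y)%E ->
  (forall i y t, i \in s -> g (dfwith y i t) = g y) ->
  iterated_integral mu (fun=> setT) s (fun y => g y * \prod_(i <- s) q i y)%E x = g x.
Proof.
move=> q0 mq + qb; elim: s g x => [|i s IH] g x q1 /=.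
  by rewrite big_nil mule1.
move=> /andP[is_ bs] g0 gs.
transitivity (\int[mu i]_t (g x * q i (dfwith x i t)))%E; last first.
  by rewrite ge0_integralZl// q1 ?mem_head// mule1.
apply: eq_integral => t _.
transitivity (iterated_integral mu (fun=> setT) s
    (fun y => (g y * q i y) * \prod_(i <- s) q i y)%E (dfwith x i t)).
  by apply: eq_iterated_integral => y _ _; rewrite big_cons muleA.
rewrite IH//.
- by rewrite gs// mem_head.
- by move=> j y js; rewrite q1// inE js orbT.
- by move=> y; rewrite mule_ge0.
- move=> j y u js; rewrite gs ?inE ?js ?orbT// qb//.
  by move/allP : is_; exact.
Qed.

Section evidence_on.
Local Open Scope ereal_scope.
Context {R : realType} {n : nat}.
Variable M : bn_model R n.
Implicit Types (S : structure n) (i : 'I_n) (Y : {set 'I_n}) (m : nat).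

Local Notation Config := (g_sigma_algebraType (config_cylinders (val_space M))).
Local Notation Sample m := (product_space (fun c : 'I_m * 'I_n => val_space M c.2)).

Lemma node_evidence_modular S1 S2 i m (D : sample M m) :
  likelihood_modularity M -> prior_modularity M -> S1 i = S2 i ->
  node_evidence S1 i D = node_evidence S2 i D.
Proof.
move=> [q loc_q] pm e.
have nodeE S : node_evidence S i D = \int[lebesgue_row R _]_(t in Defs.pset M i (S i))
    ((\prod_l (q i (S i) t (observation D l))%:E) * prior_marginal t).
  apply: eq_integral => t tS; congr (_ * _); apply: eq_bigr => l _.
  by rewrite /eloc tS loc_q//; exact: set_mem.
rewrite !{}nodeE.
(* The types of the two marginals depend on the parent sets. Both are abstracted before [e] is
   eliminated, after which the cast in prior modularity is trivial. *)
move: (@prior_marginal _ _ M S1 i) (@prior_marginal _ _ M S2 i) (pm S1 S2 i e) => p1 p2.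
move: (S1 i) (S2 i) e p1 p2 => P1 P2 e; case: _ / e => p1 p2 p12.
by apply: eq_integral => t /set_mem tS; rewrite p12// castmx_id.
Qed.

Definition joint_density S m (p : param M S * sample M m) : \bar R :=
  (\prod_i \prod_l eloc (submxrow p.1 i) (observation p.2 l)) * eprior p.1.

Lemma measurable_joint_density S m :
  measurable_fun [set: param M S * Sample m] (@joint_density S m).
Proof.
apply: emeasurable_funM; last first.
  exact: measurableT_comp (@measurable_eprior _ _ M S) measurable_fst.
apply: emeasurable_prod => i _; apply: emeasurable_prod => l _.
rewrite [X in measurable_fun _ X](_ : _ =
  (fun p : 'rV[R]_(pdim M i (S i)) * Config => eloc (S := S) p.1 p.2) \o
  (fun p : param M S * Sample m => (submxrow p.1 i, observation p.2 l : Config)))//.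
apply: measurableT_comp; first exact: measurable_eloc.
apply: measurable_fun_pair.
  apply: (measurableT_comp (@measurable_submxrow R n (fun j => pdim M j (S j)) i)).
  exact: measurable_fst.
exact: (measurableT_comp (@measurable_observation R n M m l) measurable_snd).
Qed.

Lemma joint_density_ge0 S m p : 0 <= @joint_density S m p.
Proof.
rewrite mule_ge0 ?eprior_ge0//; apply: prode_ge0 => i _.
by apply: prode_ge0 => l _; exact: eloc_ge0.
Qed.

Lemma joint_densityE S m theta (D : sample M m) : @param_set _ _ M S theta ->
  joint_density (theta, D) =
  ((\prod_l likelihood theta (observation D l)) * prior M S theta)%:E.
Proof.
move=> tS; rewrite /joint_density /eprior mem_set// EFinM/=.
congr (_ * _); rewrite exchange_big -prodEFin; apply: eq_bigr => l _.
rewrite -prodEFin; apply: eq_bigr => i _.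
by rewrite /eloc mem_set//; exact: tS.
Qed.

Lemma evidence_joint S m (D : sample M m) :
  evidence M S D =
  \int[lebesgue_row R _]_(theta in @param_set _ _ M S) joint_density (theta, D).
Proof. by apply: eq_integral => theta /set_mem tS; rewrite joint_densityE. Qed.

Lemma evidence_nodes S m (D : sample M m) : global_parameter_independence M ->
  evidence M S D = \prod_i node_evidence S i D.
Proof.
move=> gpi; rewrite evidence_joint.
have := integral_factorization gpi S [set: 'I_n]%SET D.
rewrite [RHS](eq_bigl xpredT)//; last by move=> i; rewrite finset.in_setT.
move=> <-; apply: eq_integral => theta _; congr (_ * _).
by apply: eq_bigl => i; rewrite finset.in_setT.
Qed.

Lemma eloc_dfwith S i (t : 'rV[R]_(pdim M i (S i))) m (D : sample M m) l c v :
  c != (l, i) -> (forall k, k \in S i -> c != (l, k)) ->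
  eloc (S := S) t (observation (dfwith D c v) l) = eloc (S := S) t (observation D l).
Proof.
move=> ci cS; rewrite /eloc; case: ifPn => // /set_mem tS; congr (_%:E).
apply: (loc_local R n M) => //; first by rewrite /observation dfwithout.
by move=> j jS; rewrite /observation dfwithout// cS.
Qed.

Lemma integral_eloc S i (t : 'rV[R]_(pdim M i (S i))) m (D : sample M m) l :
  Defs.pset M i (S i) t ->
  \int[ref M i]_v eloc (S := S) t (observation (dfwith D (l, i) v) l) = 1.
Proof.
move=> tS; rewrite -(loc_density R n M S i t (observation D l) tS).
apply: eq_integral => v _; rewrite /eloc mem_set//; congr (loc M S i t _)%:E.
apply: functional_extensionality_dep => j; rewrite /observation.
have [<-|ij] := eqVneq i j; first by rewrite !dfwithin.
by rewrite !dfwithout// xpair_eqE eqxx.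
Qed.

(** Since [Y] contains the parents of its elements, the likelihoods of [Y] do not involve the
    integrated observations. For fixed [theta] the likelihoods of the other nodes then integrate to
    1, provided that children are integrated out before their parents. *)
Lemma evidence_on_ancestral S Y (r : 'I_n -> nat) m (D : sample M m) :
  global_parameter_independence M ->
  (forall i k, k \in S i -> (r k < r i)%N) ->
  (forall i k, i \in Y -> k \in S i -> k \in Y) ->
  evidence_on M S Y D = \prod_(i in Y) node_evidence S i D.
Proof.
move=> gpi rS YS; rewrite -integral_factorization// /evidence_on.
set s := [seq c <- _ | _].
transitivity (iterated_integral (fun c : 'I_m * 'I_n => ref M c.2) (fun=> setT) s
    (fun D' : Sample m => \int[lebesgue_row R _]_(theta in @param_set _ _ M S)
      joint_density (theta, D')) D).
  by apply: eq_iterated_integral => y _ _; rewrite evidence_joint.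
rewrite (@iterated_integral_fubini _ _ _ (fun c : 'I_m * 'I_n => val_space M c.2)
  (fun c : 'I_m * 'I_n => ref M c.2) (fun=> setT))//; last 3 first.
- exact: measurable_param_set.
- exact: measurable_joint_density.
- exact: joint_density_ge0.
apply: eq_integral => theta /set_mem tS.
pose q (c : 'I_m * 'I_n) (y : sample M m) :=
  eloc (submxrow theta c.2) (observation y c.1).
pose g (y : sample M m) := (\prod_(i in Y) \prod_l q (l, i) y) * eprior theta.
(* Sorting the cells by rank puts children innermost: a local likelihood reads only its own cell and
   cells of strictly smaller rank. *)
pose leq_rank (c c' : 'I_m * 'I_n) := (r c.2 <= r c'.2)%N.
have us : uniq (sort leq_rank s) by rewrite sort_uniq filter_uniq// enum_uniq.
have mems c : c \in sort leq_rank s = (c.2 \notin Y).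
  by rewrite mem_sort mem_filter mem_enum andbT.
rewrite (@perm_iterated_integral _ _ _ (fun c : 'I_m * 'I_n => val_space M c.2)
  (fun c => ref M c.2) (fun=> setT) _ _ (sort leq_rank s))//; last 3 first.
- by rewrite perm_sym; exact/permPl/perm_sort.
- exact: (measurableT_comp (@measurable_joint_density S m) (measurable_pair1 _)).
- by move=> y; exact: joint_density_ge0.
transitivity (iterated_integral (fun c : 'I_m * 'I_n => ref M c.2) (fun=> setT)
    (sort leq_rank s) (fun y => g y * \prod_(c <- sort leq_rank s) q c y) D).
  apply: eq_iterated_integral => y _ _; rewrite /joint_density/= /g muleAC.
  congr (_ * _).
  have -> : \prod_(c <- sort leq_rank s) q c y = \prod_(c | c.2 \notin Y) q c y.
    rewrite (perm_big (enum [pred c : 'I_m * 'I_n | c.2 \notin Y])); last first.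
      apply: uniq_perm => //; first exact: enum_uniq.
      by move=> c; rewrite mems mem_enum.
    by rewrite big_enum.
  rewrite [LHS](bigID (mem Y))/=; congr (_ * _).
  rewrite exchange_big.
  rewrite (pair_big xpredT (fun i => i \notin Y) (fun l i => q (l, i) y))/=.
  by apply: eq_bigr => -[].
(* Cells of equal rank do occur, at least across observations, so the relation is the weak order
   together with distinctness; distinctness holds pairwise because the list has no repetition. *)
rewrite (@iterated_integral_marginalize _ _ _ _ _ q
  (fun c c' => (c != c') && leq_rank c c')).
- rewrite /g /q; congr (_ * _).
- by move=> c y; exact: eloc_ge0.
- move=> c y; rewrite [X in measurable_fun _ X](_ : _ =
    (fun p : 'rV[R]_(pdim M c.2 (S c.2)) * Config => eloc (S := S) p.1 p.2) \o
    (fun v => (submxrow theta c.2, observation (dfwith y c v) c.1 : Config)))//.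
  apply: (measurableT_comp (measurable_eloc (S := S) (i := c.2))).
  apply: measurable_fun_pair => //.
  apply: (measurableT_comp (@measurable_observation R n M m c.1)).
  exact: measurable_fun_dfwith.
- by move=> [l i] y _; apply: integral_eloc; exact: tS.
- move=> [l i] c y v /andP[nc rc]; apply: eloc_dfwith; first by rewrite eq_sym.
  move=> k /rS kr; apply: contraTneq rc => ->.
  by rewrite /leq_rank/= -ltnNge.
- rewrite pairwise_relI -uniq_pairwise us/= -sorted_pairwise; last first.
    by move=> c1 c2 c3; exact: leq_trans.
  by apply: sort_sorted => c1 c2; exact: leq_total.
- move=> y; rewrite mule_ge0 ?eprior_ge0//; apply: prode_ge0 => i _.
  by apply: prode_ge0 => l _; exact: eloc_ge0.
- move=> c y v; rewrite mems => cY; congr (_ * _).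
  apply: eq_bigr => i iY; apply: eq_bigr => l _; apply: eloc_dfwith.
    by apply: contraNneq cY => ->.
  by move=> k kS; apply: contraNneq cY => -> /=; exact: YS kS.
Qed.

End evidence_on.

(** * Complete structures *)

Section complete_structures.
Context {n : nat}.
Implicit Types (S : structure n) (i j k : 'I_n).

Lemma structure_irrefl S i : i \notin S i.
Proof.
apply/negP => ii; suff : [:: i] = [::] by [].
by apply: (@parents_acyclic _ S); rewrite /= /Defs.arc ii.
Qed.

Lemma structure_asym S i j : j \in S i -> i \notin S j.
Proof.
move=> ji; apply/negP => ij; suff : [:: j; i] = [::] by [].
by apply: (@parents_acyclic _ S); rewrite /= /Defs.arc ji ij.
Qed.

Lemma complete_trans S i j k : complete S ->
  k \in S j -> j \in S i -> k \in S i.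
Proof.
move=> cS kj ji; have [ki|ki] := eqVneq k i.
  by rewrite ki in kj; have := structure_asym ji; rewrite kj.
(* An arc from [i] to [k] would close a directed cycle of length three. *)
case/orP : (cS k i ki) => // ik; suff : [:: k; j; i] = [::] by [].
by apply: (@parents_acyclic _ S); rewrite /= /Defs.arc kj ji ik.
Qed.

(** The number of parents is the rank. By transitivity the parents of a parent of [i] form a proper
    subset of the parents of [i], so the count increases along arcs; as any two nodes are joined,
    the counts are distinct and below [n]. *)
Lemma complete_compatible_ordering S : complete S ->
  exists u : 'S_n, compatible_ordering S u.
Proof.
move=> cS; have ltSn i : (#|S i| < n)%N.
  rewrite -[X in (_ < X)%N]card_ord -cardsT; apply: proper_card.
  apply/properP; split; first exact: finset.subsetT.
  by exists i; rewrite ?finset.in_setT ?structure_irrefl.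
have cardS i j : j \in S i -> (#|S j| < #|S i|)%N.
  move=> ji; apply: proper_card; apply/properP; split.
    by apply/fintype.subsetP => k kj; exact: complete_trans ji.
  by exists j => //; exact: structure_irrefl.
have inj : injective (fun i => Ordinal (ltSn i)).
  move=> i j [eij]; apply/eqP; apply: contraPT eij => ij.
  by case/orP : (cS i j ij) => /cardS; rewrite ltn_neqAle => /andP[/eqP + _] => // + /esym.
by exists (perm inj) => i j ji; rewrite !permE; exact: cardS.
Qed.

(** In a complete structure no node has a non-parent predecessor, so the ordered Markov condition
    holds for every family of variables. An assertion represented by such a structure is thus true
    of all families, a property that does not mention the structure. *)
Lemma complete_independence_equivalent (R : realType) S1 S2 :
  complete S1 -> complete S2 -> independence_equivalent R S1 S2.
Proof.
suff repr S S' A B C : complete S -> complete S' ->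
    represents R S A B C -> represents R S' A B C.
  by move=> c1 c2 A B C _ _ _; split; exact: repr.
move=> cS cS' [u uS SABC]; have [v vS] := complete_compatible_ordering cS'.
exists v => // d Omega P dv W X _; apply: SABC => i.
rewrite (_ : _ :\: _ = finset.set0)%SET; first by move=> E g; rewrite finset.set0U.
apply/setP => j; rewrite !inE; apply/negbTE; rewrite negb_and negbK.
case: (boolP (j \in S i)) => //= jSi; rewrite -leqNgt.
have [->//|ij] := eqVneq i j.
by case/orP : (cS i j ij) => [/uS/ltnW//|]; rewrite (negbTE jSi).
Qed.

Lemma rank_acyclic (r : 'I_n -> nat) (c : seq 'I_n) :
  cycle (Defs.arc [ffun i => [set k | (r k < r i)%N]%SET]) c -> c = [::].
Proof.
case: c => // x s /= px.
have : path (fun j i => r j < r i)%N x (rcons s x).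
  by apply: sub_path px => j i; rewrite /Defs.arc ffunE inE.
have tr : transitive (fun j i => r j < r i)%N by move=> a b c; exact: ltn_trans.
by move=> /(order_path_min tr); rewrite all_rcons ltnn.
Qed.

Definition rank_structure (r : 'I_n -> nat) : structure n :=
  Structure (@rank_acyclic r).

Lemma rank_structureE r i k : (k \in rank_structure r i) = (r k < r i)%N.
Proof. by rewrite ffunE inE. Qed.

Lemma rank_structure_complete r : injective r -> complete (rank_structure r).
Proof.
move=> ri i j ij; rewrite !rank_structureE -neq_ltn.
by apply: contra ij => /eqP/ri ->.
Qed.

(* The total order with [P] first, then [i], then the other nodes. *)
Definition initial_rank (P : {set 'I_n}) i j : nat :=
  ((if j \in P then 0 else if j == i then 1 else 2) * n + j)%N.

Lemma initial_rank_inj P i : injective (initial_rank P i).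
Proof.
move=> j k /(congr1 (modn^~ n)); rewrite /initial_rank !modnMDl.
by rewrite !modn_small// => /val_inj.
Qed.

Lemma initial_rank_lt (P : {set 'I_n}) i k : i \notin P ->
  (initial_rank P i k < initial_rank P i i)%N = (k \in P).
Proof.
move=> iP; rewrite /initial_rank (negbTE iP) eqxx mul1n.
have := ltn_ord k; have := ltn_ord i.
case: ifPn => kP; first by lia.
case: eqP => [->|_]; lia.
Qed.

Lemma initial_rank_in (P : {set 'I_n}) i j k : j \in P ->
  (initial_rank P i k < initial_rank P i j)%N -> k \in P.
Proof.
move=> jP; rewrite /initial_rank jP mul0n; have := ltn_ord j.
by case: ifPn => // kP; case: eqP => _; lia.
Qed.

End complete_structures.

(** Only the divisor must be finite and positive; [a] will be a node evidence, which might be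
    infinite. *)
Lemma mule_divr (R : realType) (a b : \bar R) : (0 < b < +oo)%E -> (a * b / b = a)%E.
Proof.
case: b => [b| |]; rewrite ?ltxx ?andbF// => /andP[b0 _].
by rewrite -muleA inver gt_eqF// -EFinM divff ?mule1// gt_eqF.
Qed.

Lemma evidence_quotient (R : realType) n (M : bn_model R n) (Sc S : structure n) m
    (D : sample M m) :
  global_parameter_independence M -> likelihood_modularity M ->
  prior_modularity M -> complete Sc ->
  (forall S1 S2 (D : sample M m), complete S1 -> complete S2 ->
     evidence M S1 D = evidence M S2 D) ->
  (forall i, (0 < evidence_on M Sc (S i) D < +oo)%E) ->
  evidence M S D =
  (\prod_i (evidence_on M Sc (i |: S i)%SET D / evidence_on M Sc (S i) D))%E.
Proof.
move=> gpi lm pm cSc eq_evidence Dfin; rewrite evidence_nodes//.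
apply: eq_bigr => i _; have iS := structure_irrefl S i.
pose r := initial_rank (S i) i; pose S' := rank_structure r.
have cS' : complete S' by apply: rank_structure_complete; exact: initial_rank_inj.
have S'i : S' i = S i by apply/setP => k; rewrite rank_structureE initial_rank_lt.
(* The integrands of the two marginal evidences agree at every completed sample [D']. *)
have onE Y : evidence_on M Sc Y D = evidence_on M S' Y D.
  by apply: eq_iterated_integral => D' _ _; exact: eq_evidence.
have rS' j k : k \in S' j -> (r k < r j)%N by rewrite rank_structureE.
have onS : evidence_on M Sc (S i) D = (\prod_(j in S i) node_evidence S' j D)%E.
  rewrite onE (evidence_on_ancestral _ gpi rS')// => j k jS /rS'.
  exact: initial_rank_in.
have onU : evidence_on M Sc (i |: S i)%SET D =
    (node_evidence S' i D * \prod_(j in S i) node_evidence S' j D)%E.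
  rewrite onE (evidence_on_ancestral _ gpi rS') ?big_setU1//= => j k.
  rewrite !inE => /orP[/eqP ->|jS] /rS'.
    by rewrite initial_rank_lt// => ->; rewrite orbT.
  by move=> /(initial_rank_in jS) ->; rewrite orbT.
by rewrite onU -onS mule_divr//; exact: node_evidence_modular.
Qed.

(** * Dyadic cells *)

Lemma measure_le_cover2 d (T : measurableType d) (R : realType)
    (mu : {measure set T -> \bar R}) (A B C : set T) (a b : \bar R) :
  measurable A -> measurable B -> measurable C -> A `<=` B `|` C ->
  (mu B <= a)%E -> (mu C <= b)%E -> (mu A <= a + b)%E.
Proof.
move=> mA mB mC ABC Ba Cb; apply: le_trans (leeD Ba Cb).
apply: le_trans (measureU2 _ mB mC); rewrite le_measure ?inE//.
exact: measurableU.
Qed.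

(** The sets approximable by [G] up to any [e] form a sigma-algebra. Complements exchange the two
    differences; a countable union is first replaced by a finite one, at cost [e / 2], using
    continuity from below of a finite measure. *)
Lemma approximation_by_algebra d (T : measurableType d) (R : realType)
    (mu : {measure set T -> \bar R}) (G : set (set T)) :
  (mu setT < +oo)%E -> G `<=` measurable -> G set0 ->
  (forall A, G A -> G (~` A)) -> (forall A B, G A -> G B -> G (A `|` B)) ->
  forall F, <<s G >> F -> forall e : R, 0 < e ->
  exists A, [/\ G A, (mu (F `\` A) <= e%:E)%E & (mu (A `\` F) <= e%:E)%E].
Proof.
move=> muT mG G0 GC GU F GF.
pose D := [set F | measurable F /\ forall e : R, 0 < e ->
  exists A, [/\ G A, (mu (F `\` A) <= e%:E)%E & (mu (A `\` F) <= e%:E)%E]].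
suff : D F by case.
have fin A : measurable A -> mu A \is a fin_num.
  move=> mA; rewrite ge0_fin_numE//; apply: le_lt_trans muT.
  by rewrite le_measure ?inE.
have DU A B : D A -> D B -> D (A `|` B).
  move=> [mA hA] [mB hB]; split; first exact: measurableU.
  move=> e e0; have e20 : 0 < e / 2 by rewrite divr_gt0.
  have [A' [GA' A1 A2]] := hA _ e20; have [B' [GB' B1 B2]] := hB _ e20.
  have mA' := mG _ GA'; have mB' := mG _ GB'.
  have half : e%:E = ((e / 2)%:E + (e / 2)%:E)%E by rewrite -EFinD -splitr.
  exists (A' `|` B'); split; first exact: GU.
    rewrite half; apply: measure_le_cover2 A1 B1; do ?exact: measurableD.
      by apply: measurableD; exact: measurableU.
    by move=> x [[Ax|Bx] /not_orP[nA nB]]; [left|right].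
  rewrite half; apply: measure_le_cover2 A2 B2; do ?exact: measurableD.
    by apply: measurableD; exact: measurableU.
  by move=> x [[Ax|Bx] /not_orP[nA nB]]; [left|right].
have D0 : D set0.
  split=> // e e0; exists set0; split=> //; rewrite setD0 measure0 lee_fin ltW//.
apply: GF; split; last first.
  move=> A GA; split; first exact: mG.
  by move=> e e0; exists A; rewrite setDv measure0 lee_fin ltW.
split=> //.
  move=> A [mA hA]; rewrite setTD; split; first exact: measurableC.
  move=> e /hA[B [GB B1 B2]]; exists (~` B); split; first exact: GC.
    by rewrite setDE setCK setIC -setDE.
  by rewrite setDE setCK setIC -setDE.
move=> A DA; have mA i : measurable (A i) by case: (DA i).
have mU : measurable (\bigcup_i A i) by exact: bigcupT_measurable.
split => // e e0; have e20 : 0 < e / 2 by rewrite divr_gt0.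
pose V n := \big[setU/set0]_(i < n.+1) A i.
have DV n : D (V n).
  by rewrite /V; elim: n.+1 => [|k IH]; rewrite ?big_ord0// big_ord_recr/=; exact: DU.
have mV n : measurable (V n) by case: (DV n).
have UV : \bigcup_i A i = \bigcup_n V n by rewrite /V bigcup_bigsetU_bigcup.
have cvgV : mu \o V @ \oo --> mu (\bigcup_i A i).
  rewrite UV; apply: nondecreasing_cvg_mu => //; first by rewrite -UV.
  by move=> n m nm; apply/subsetPset; exact: subset_bigsetU.
have [n Vn] : exists n, (mu (\bigcup_i A i `\` V n) <= (e / 2)%:E)%E.
  apply: contrapT => /forallNP H; have finU := fin _ mU.
  have VU n : V n `<=` \bigcup_i A i by rewrite UV; exact: bigcup_sup.
  have : (limn (mu \o V) <= mu (\bigcup_i A i) - (e / 2)%:E)%E.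
    apply: lime_le; first by apply/cvg_ex; eexists; exact: cvgV.
    apply: nearW => n; rewrite /=.
    have -> : mu (\bigcup_i A i) = (mu (\bigcup_i A i `\` V n) + mu (V n))%E.
      by rewrite (measureDI mu mU (mV n)) (setIidr (VU n)).
    move: (H n) => /negP; rewrite -ltNge.
    have mUV : measurable (\bigcup_i A i `\` V n) by exact: measurableD.
    have := fin _ mUV; have := fin _ (mV n).
    move: (mu (V n)) (mu (\bigcup_i A i `\` V n)) => [v| |] [u| |]// _ _.
    by rewrite lte_fin -!EFinD lee_fin => ?; lra.
  rewrite (cvg_lim _ cvgV)//; case: (mu _) finU => // u _.
  by rewrite -EFinD lee_fin lerDl oppr_ge0 leNgt e20.
have [_ /(_ _ e20)[B [GB B1 B2]]] := DV n; have mB := mG _ GB.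
exists B; split => //.
  have -> : e%:E = ((e / 2)%:E + (e / 2)%:E)%E by rewrite -EFinD -splitr.
  apply: measure_le_cover2 Vn B1; do ?exact: measurableD.
  by move=> x [Ux nB]; have [Vx|nV] := pselect (V n x); [right|left].
apply: (@le_trans _ _ (e / 2)%:E); last by rewrite lee_fin; lra.
apply: le_trans B2; rewrite le_measure ?inE//; do ?exact: measurableD.
by move=> x [Bx nU]; split=> // Vx; apply: nU; rewrite UV; exists n.
Qed.

Lemma measurable_preimage_countable d (T : measurableType d) (C : countType)
    (h : T -> C) (W : set C) :
  (forall z, measurable (h @^-1` [set z])) -> measurable (h @^-1` W).
Proof.
move=> mh; rewrite (_ : _ @^-1` W = \bigcup_n
    (if unpickle n is Some z then if z \in W then h @^-1` [set z] else set0 else set0)).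
  apply: bigcupT_measurable => n; case: unpickle => [z|]; last exact: measurable0.
  by case: ifPn.
apply/seteqP; split => [x Wx|x [n _]].
  by exists (pickle (h x)) => //; rewrite pickleK mem_set.
by case: unpickle => // z; case: ifPn => // /set_mem Wz /= ->.
Qed.

Lemma measure_le_countable d (T : measurableType d) (R : realType) (C : countType)
    (h : T -> C) (mu nu : {measure set T -> \bar R}) (F : set T) :
  (forall z, measurable (h @^-1` [set z])) -> measurable F ->
  (forall z, mu (F `&` h @^-1` [set z]) <= nu (F `&` h @^-1` [set z]))%E ->
  (mu F <= nu F)%E.
Proof.
move=> mh mF le; pose L n := if unpickle n is Some z then
  if pickle z == n then F `&` h @^-1` [set z] else set0 else set0.
have FL : F = \bigcup_n L n.
  apply/seteqP; split => [x Fx|x [n _]].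
    by exists (pickle (h x)) => //; rewrite /L pickleK eqxx.
  by rewrite /L; case: unpickle => // z; case: ifP => // _ [].
have mL n : measurable (L n).
  rewrite /L; case: unpickle => // z; case: ifP => // _; exact: measurableI.
have tL : trivIset setT L.
  move=> i j _ _ [x []]; rewrite /L.
  case ui : (unpickle i) => [z|]// => /[swap].
  case uj : (unpickle j) => [w|]//.
  by do 2 case: eqP => // <-; move=> [_ /= ->] [_ /= ->].
rewrite FL !measure_semi_bigcup -?FL//; apply: lee_nneseries => [n _|n _].
  by move=> _; exact: measure_ge0.
rewrite /L; case: unpickle => [z|]; last by rewrite !measure0.
by case: ifP => // _; rewrite !measure0.
Qed.

(** * Boxes, dyadic cubes, and comparison of measures on them *)

Lemma measurable_box (R : realType) N (X : 'I_N -> set (measurableTypeR R)) :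
  (forall i, measurable (X i)) ->
  measurable [set v : 'rV[R]_N | forall i, X i (v ord0 i)].
Proof.
move=> mX; rewrite (_ : mkset _ = \bigcap_(i in [set: 'I_N])
    ((fun v : 'rV[R]_N => v ord0 i) @^-1` X i)).
  apply: fin_bigcap_measurable => // i _; rewrite -[Y in measurable Y]setTI.
  exact: (@measurable_row_coord R N i measurableT _ (mX i)).
by apply/seteqP; split => v vA i; [move=> _; exact: vA|exact: vA].
Qed.

Lemma lebesgue_row_box (R : realType) N (X : 'I_N -> set (measurableTypeR R)) :
  (forall i, measurable (X i)) ->
  lebesgue_row R N [set v : 'rV[R]_N | forall i, X i (v ord0 i)] =
  (\prod_i lebesgue_measure (X i))%E.
Proof.
move=> mX; set B := mkset _.
have mB : measurable B by exact: measurable_box.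
rewrite -[B]setIT -integral_indic// (@integral_coordinates _ _ _ (fun=> 0)); last 2 first.
- exact/measurable_EFinP/measurable_indic.
- by move=> v; rewrite lee_fin.
rewrite -big_enum/=.
transitivity (\prod_(i <- enum 'I_N) \int[lebesgue_measure]_(t in [set: measurableTypeR R])
    (\1_(X i) t)%:E)%E; last first.
  by apply: eq_bigr => i _; rewrite integral_indic// setIT.
rewrite -(@iterated_integral_prod R _ _ (fun _ : 'I_N => measurableTypeR R)
  (fun=> lebesgue_measure) _ _ _ (fun i t => (\1_(X i) t)%:E) (fun=> 0)) ?enum_uniq//.
- apply: eq_iterated_integral => y _ _; rewrite prodEFin; congr (_%:E).
  rewrite big_enum/= indicE; have [/set_mem By|nBy] := boolP (_ \in B).
    rewrite big1// => i _; rewrite indicE mem_set//.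
    by have := By i; rewrite mxE.
  apply/esym/eqP; rewrite prodf_seq_eq0; apply/hasP.
  have [i nXi] : exists i, ~ X i (y i).
    apply/existsNP => XA; apply/negP: nBy; rewrite negbK; apply/mem_set => i.
    by rewrite mxE; exact: XA.
  by exists i; rewrite ?mem_index_enum//= indicE memNset.
- by move=> i; exact/measurable_EFinP/measurable_indic.
Qed.

Section cells.
Context {R : realType} (N : nat).
Implicit Types (u v : 'rV[R]_N) (k : nat) (z : 'rV[int]_N).

(** The index of the half-open dyadic cube of side [2 ^- k] containing [v]. Cubes of level [k] are
    the fibres of [cell k], and arbitrary unions of them are preimages. *)
Definition cell k v : 'rV[int]_N := \row_i Num.floor (2 ^+ k * v ord0 i).

Lemma cellP k v z : cell k v = z <->
  forall i, (z ord0 i)%:~R / 2 ^+ k <= v ord0 i < (z ord0 i + 1)%:~R / 2 ^+ k.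
Proof.
have e i : ((z ord0 i)%:~R / 2 ^+ k <= v ord0 i < (z ord0 i + 1)%:~R / 2 ^+ k) =
    (Num.floor (2 ^+ k * v ord0 i) == z ord0 i).
  by rewrite floor_eq ler_pdivrMr ?exprn_gt0// ltr_pdivlMr ?exprn_gt0// !(mulrC (2 ^+ k)).
split => [zv i|zv]; first by rewrite e -zv mxE.
by apply/rowP => i; apply/eqP; rewrite mxE -e.
Qed.

(** The integer [2 ^+ (k' - k)] times the coarse floor of [x] is at most [2 ^+ k' * x], hence at
    most the fine floor, which [x] and [y] share. So the coarse floor of [x] is at most that of [y],
    and conversely. *)
Lemma cell_refine k k' u v : (k <= k')%N ->
  cell k' u = cell k' v -> cell k u = cell k v.
Proof.
move=> kk' /rowP e; apply/rowP => i; have := e i; rewrite !mxE.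
move: (u ord0 i) (v ord0 i) => {e}a b.
suff H (x y : R) : Num.floor (2 ^+ k' * x) = Num.floor (2 ^+ k' * y) ->
    Num.floor (2 ^+ k * x) <= Num.floor (2 ^+ k * y) :> int.
  by move=> e; apply/eqP; rewrite eq_le !H.
move=> e; rewrite floor_ge_int.
have p0 : 0 < 2 ^+ (k' - k) :> R by rewrite exprn_gt0.
have E w : 2 ^+ k' * w = 2 ^+ (k' - k) * (2 ^+ k * w) :> R.
  by rewrite mulrA -exprD subnK.
have M : (2 ^+ (k' - k) * Num.floor (2 ^+ k * x))%:~R =
    2 ^+ (k' - k) * (Num.floor (2 ^+ k * x))%:~R :> R by rewrite intrM rmorphXn.
rewrite -(ler_pM2l p0) -E -M -floor_ge_int -e floor_ge_int M E ler_pM2l//.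
exact: floor_le.
Qed.

Lemma cell_dist k u v i : cell k u = cell k v -> `|u ord0 i - v ord0 i| <= 2 ^- k.
Proof.
move=> uv; have /cellP/(_ i)/andP[u1 u2] := uv.
have /cellP/(_ i)/andP[v1 v2] := erefl (cell k v).
move: u1 u2 v1 v2; rewrite intrD mulrDl mul1r; set c := _ / _ => *.
by rewrite ler_norml; apply/andP; split; lra.
Qed.

Lemma cell_preimage_box k z : cell k @^-1` [set z] = [set v : 'rV[R]_N | forall i,
  `[(z ord0 i)%:~R / 2 ^+ k, (z ord0 i + 1)%:~R / 2 ^+ k[%classic (v ord0 i)].
Proof.
apply/seteqP; split => v /= => [/cellP H i|H]; first by rewrite in_itv/=.
by apply/cellP => i; have := H i; rewrite /= in_itv.
Qed.

Lemma measurable_cell_preimage1 k z : measurable (cell k @^-1` [set z]).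
Proof.
rewrite cell_preimage_box; apply: (measurable_box (X := fun i =>
  `[(z ord0 i)%:~R / 2 ^+ k, (z ord0 i + 1)%:~R / 2 ^+ k[%classic)) => i.
exact: measurable_itv.
Qed.

Lemma measurable_cell_preimage k W : measurable (cell k @^-1` W).
Proof. exact: measurable_preimage_countable (@measurable_cell_preimage1 k). Qed.

Lemma lebesgue_row_cell k z :
  lebesgue_row R N (cell k @^-1` [set z]) = ((2 ^- k) ^+ N)%:E.
Proof.
rewrite cell_preimage_box (lebesgue_row_box (X := fun i =>
  `[(z ord0 i)%:~R / 2 ^+ k, (z ord0 i + 1)%:~R / 2 ^+ k[%classic)); last first.
  by move=> i; exact: measurable_itv.
rewrite (eq_bigr (fun=> (2 ^- k)%:E)) ?prodEFin ?prodr_const ?card_ord// => i _.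
rewrite lebesgue_measure_itv/= lte_fin ltr_pM2r ?invr_gt0 ?exprn_gt0// ltr_int ltrDl ltr01.
by rewrite -EFinB intrD mulrDl addrC addKr mul1r.
Qed.

(** Levels below [k0] are excluded because the measures to be compared are controlled on small cubes
    only. *)
Definition cell_sets k0 : set (set 'rV[R]_N) :=
  [set A | exists k W, (k0 <= k)%N /\ A = cell k @^-1` W].

Lemma cell_sets_setU k0 A B : cell_sets k0 A -> cell_sets k0 B -> cell_sets k0 (A `|` B).
Proof.
move=> [k [W [k0k ->]]] [k' [W' [k0k' ->]]].
pose l := maxn k k'; exists l, (cell l @` (cell k @^-1` W `|` cell k' @^-1` W')).
split; first by rewrite leq_max k0k.
apply/seteqP; split => [v H|v [u H uv]]; first by exists v.
have uvk := cell_refine (leq_maxl k k') uv; have uvk' := cell_refine (leq_maxr k k') uv.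
by rewrite /= -uvk -uvk'.
Qed.

Lemma cell_sets_generate k0 F : measurable F -> <<s cell_sets k0 >> F.
Proof.
move=> mF; suff : measurable_fun setT
  (id : g_sigma_algebraType (cell_sets k0) -> 'rV[R]_N).
  by move=> /(_ measurableT _ mF); rewrite setTI.
apply: measurable_fun_rowP => i.
apply: (measurability _ (RGenInftyO.measurableE R)) => _ [_ [a ->] <-].
rewrite setTI.
(* The half-space is the union of the cubes whose upper face in direction [i] does not pass [a]; a
   point is reached once the side is at most its distance to the boundary. *)
rewrite (_ : _ @^-1` _ = \bigcup_k (cell (k0 + k) @^-1`
    [set z | (z ord0 i + 1)%:~R <= 2 ^+ (k0 + k) * a])).
  apply: bigcupT_measurable => k; apply: sub_sigma_algebra.
  by eexists; eexists; split; last reflexivity; exact: leq_addr.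
apply/seteqP; split => [v /=|v [k _ /=]]; rewrite in_itv/=.
  move=> va; have [k Hk] : exists k, (a - v ord0 i)^-1 <= 2 ^+ (k0 + k).
    set x := _^-1; exists (Num.bound x); apply: ltW.
    exact/Num.Theory.upper_nthrootP/leq_addl.
  exists k => //=; rewrite mxE intrD.
  have p0 : 0 < 2 ^+ (k0 + k) :> R by rewrite exprn_gt0.
  have := floor_le (2 ^+ (k0 + k) * v ord0 i).
  rewrite invf_ple ?posrE ?subr_gt0// in Hk.
  move: Hk; rewrite -(ler_pM2l p0) divff ?gt_eqF// mulrBr; lra.
rewrite mxE => H; have p0 : 0 < 2 ^+ (k0 + k) :> R by rewrite exprn_gt0.
rewrite -(ltr_pM2l p0); apply: lt_le_trans H.
by have /andP[] := floor_itv (2 ^+ (k0 + k) * v ord0 i).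
Qed.

(** The inequality passes from cubes to countable unions of cubes of one level, and from these to
    Borel sets by approximation. Approximation needs finite measures, so the space is first split
    into the cubes of level [k0]. *)
Lemma measure_le_of_cells k0 (mu nu : {measure set 'rV[R]_N -> \bar R}) F :
  (forall k z, (k0 <= k)%N ->
    (mu (cell k @^-1` [set z]) <= nu (cell k @^-1` [set z]))%E) ->
  (forall z, (nu (cell k0 @^-1` [set z]) < +oo)%E) ->
  measurable F -> (mu F <= nu F)%E.
Proof.
move=> le fin mF; apply: (measure_le_countable (h := cell k0)) => //.
  exact: measurable_cell_preimage1.
have leW k W : (k0 <= k)%N -> (mu (cell k @^-1` W) <= nu (cell k @^-1` W))%E.
  move=> k0k; apply: (measure_le_countable (h := cell k)).
  - exact: measurable_cell_preimage1.
  - exact: measurable_cell_preimage.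
  move=> z; have [zW|zW] := pselect (W z).
    by rewrite setIC (setIidl (B := cell k @^-1` W)) ?le// => v /= ->.
  rewrite (_ : _ `&` _ = set0) ?measure0//.
  by apply/seteqP; split => // v [/= Wv vz]; apply: zW; rewrite -vz.
move=> z; set K := cell k0 @^-1` [set z].
have mK : measurable K by exact: measurable_cell_preimage1.
have muK : (mu K < +oo)%E by apply: le_lt_trans (fin z); exact: le.
(* Approximating for the sum yields one set [G] that is close to [F] for both measures. *)
pose m : {measure set 'rV[R]_N -> \bar R} := measure_add (mrestr mu mK) (mrestr nu mK).
have mE A : m A = (mu (A `&` K) + nu (A `&` K))%E by exact: measure_addE.
apply/lee_addgt0Pr => e e0; have e20 : 0 < e / 2 by rewrite divr_gt0.
have [] := @approximation_by_algebra _ _ _ m (cell_sets k0) _ _ _ _ _ F _ (e / 2) e20.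
- by rewrite mE !setTI lte_add_pinfty//; exact: fin.
- by move=> _ [k [W [_ ->]]]; exact: measurable_cell_preimage.
- by exists k0, set0.
- by move=> _ [k [W [k0k ->]]]; exists k, (~` W).
- by move=> A B; exact: cell_sets_setU.
- exact: cell_sets_generate.
move=> _ [[k [W [k0k ->]]]]; set G := _ @^-1` _; rewrite !mE => FG GF.
have mG : measurable G by exact: measurable_cell_preimage.
have GK : (mu (G `&` K) <= nu (G `&` K))%E.
  (* As [k] is at least [k0], cubes of level [k] do not straddle the boundary of [K], so the trace
     of [G] on [K] is again a union of such cubes. *)
  pose W' := W `&` (cell k @` K).
  rewrite (_ : G `&` K = cell k @^-1` W'); first exact: leW.
  apply/seteqP; split => [v [Gv Kv]|v [Wv [u Ku uv]]]; first by split=> //; exists v.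
  by split=> //; rewrite /K /= -(cell_refine k0k uv).
have -> : e%:E = ((e / 2)%:E + (e / 2)%:E)%E by rewrite -EFinD -splitr.
have h1 : (mu (F `&` K) <= mu (G `&` K) + (e / 2)%:E)%E.
  apply: (@measure_le_cover2 _ _ _ _ _ (G `&` K) ((F `\` G) `&` K)) => //.
  - exact: measurableI.
  - exact: measurableI.
  - by apply: measurableI => //; exact: measurableD.
  - by move=> v [Fv Kv]; have [Gv|nGv] := pselect (G v); [left|right].
  - by apply: le_trans FG; rewrite leeDl.
have h2 : (nu (G `&` K) <= nu (F `&` K) + (e / 2)%:E)%E.
  apply: (@measure_le_cover2 _ _ _ _ _ (F `&` K) ((G `\` F) `&` K)) => //.
  - exact: measurableI.
  - exact: measurableI.
  - by apply: measurableI => //; exact: measurableD.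
  - by move=> v [Fv Kv]; have [Gv|nGv] := pselect (F v); [left|right].
  - by apply: le_trans GF; rewrite leeDr.
apply: le_trans h1 _; rewrite addeA leeD2r//.
exact: le_trans GK h2.
Qed.

End cells.

(** * Rows: topology and Borel sets *)

Section row_topology.
Context {R : realType}.

Lemma row_norm_coord N (v : 'rV[R]_N) i : `|v ord0 i| <= `|v|.
Proof.
rewrite [leRHS]mx_normrE; exact: (le_bigmax _ (fun ij => `|v ij.1 ij.2|) (ord0, i)).
Qed.

Lemma row_norm_le N (v : 'rV[R]_N) c :
  0 <= c -> (forall i, `|v ord0 i| <= c) -> `|v| <= c.
Proof.
move=> c0 vc; rewrite [leLHS]mx_normrE; apply/bigmax_leP; split => // -[i j] _.
by rewrite (ord1 i).
Qed.

Lemma cell_norm N k (u v : 'rV[R]_N) : cell k u = cell k v -> `|u - v| <= 2 ^- k.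
Proof.
move=> uv; apply: row_norm_le; first by rewrite invr_ge0 exprn_ge0.
by move=> i; rewrite !mxE; exact: cell_dist.
Qed.

Lemma exists_expr2V_lt (e : R) : 0 < e -> exists k, 2 ^- k < e.
Proof.
move=> e0; exists (Num.bound e^-1); rewrite invf_plt ?posrE ?exprn_gt0//.
exact: Num.Theory.upper_nthrootP.
Qed.

(** An open set is the union of the dyadic cubes it contains. This links the norm topology to the
    sigma-algebra generated by coordinates. *)
Lemma measurable_open_row N (U : set 'rV[R]_N) : open U -> measurable U.
Proof.
move=> oU; rewrite (_ : U = \bigcup_k (cell k @^-1`
    [set z | cell k @^-1` [set z] `<=` U])).
  by apply: bigcupT_measurable => k; exact: measurable_cell_preimage.
apply/seteqP; split => [x Ux|x [k _ /= kU]]; last exact: kU.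
have /nbhs_normP[e /= e0 xeU] : nbhs x U by exact: open_nbhs_nbhs.
have [k ke] := exists_expr2V_lt e0; exists k => // u /= ux; apply: xeU.
by rewrite /=; apply: le_lt_trans ke; apply: cell_norm.
Qed.

Lemma measurable_fun_rowP_in d (T : measurableType d) N (D : set T) (f : T -> 'rV[R]_N) :
  measurable D -> (forall k, measurable_fun D (fun t => f t ord0 k)) ->
  measurable_fun D f.
Proof.
move=> mD mf; apply/(measurable_restrictT f mD).
apply: measurable_fun_rowP => k; have /(measurable_restrictT _ mD) := mf k.
apply: eq_measurable_fun => t _; rewrite !patchE; case: ifPn => // _.
by rewrite [RHS]mxE.
Qed.

Lemma continuous_at_measurable N M (B : set 'rV[R]_N) (f : 'rV[R]_N -> 'rV[R]_M) :
  measurable B -> (forall x, B x -> {for x, continuous f}) -> measurable_fun B f.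
Proof.
move=> mB cf; apply: measurable_fun_rowP_in => // k.
apply: (measurability _ (RGenInftyO.measurableE R)) => _ [_ [a ->] <-].
set g := fun t => f t ord0 k.
(* Continuity at a point of [B] is with respect to the whole space, so each point of [B] in the
   preimage is interior to it, although [B] itself need not be open. *)
rewrite (_ : _ `&` _ = B `&` (g @^-1` `]-oo, a[)°).
  apply: measurableI => //; apply: measurable_open_row; exact: open_interior.
apply/seteqP; split => x [Bx gx]; split => //; last exact: interior_subset gx.
have cg : {for x, continuous g}.
  apply: (@continuous_comp _ _ _ f (fun v : 'rV[R]_M => v ord0 k) x); first exact: cf.
  exact: coord_continuous.
by apply: cg; apply: open_nbhs_nbhs; split => //; exact: itv_open.
Qed.

Lemma differentiable_approx N M (f : 'rV[R]_N -> 'rV[R]_M) x (e : R) : 0 < e ->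
  differentiable f x ->
  exists2 r : R, 0 < r & forall y, `|y - x| < r ->
    `|f y - f x - (y - x) *m jacobian f x| <= e * `|y - x|.
Proof.
move=> e0 /diff_locally /eqaddoP /(_ e e0) /nbhs_norm0P[r /= r0 H].
exists r => // y /H /=; rewrite !fctE /= subrK opprD addrA => h.
by rewrite /jacobian mul_rV_lin1.
Qed.

Lemma row_norm_mulmx_le N M (A : 'M[R]_(N, M)) (v : 'rV[R]_N) :
  `|v *m A| <= (\sum_i \sum_j `|A i j|) * `|v|.
Proof.
have s0 : 0 <= \sum_i \sum_j `|A i j|.
  by rewrite sumr_ge0// => i _; rewrite sumr_ge0.
apply: row_norm_le => [|j]; first by rewrite mulr_ge0.
rewrite mxE; apply: le_trans (ler_norm_sum _ _ _) _.
rewrite mulr_suml; apply: ler_sum => i _; rewrite normrM mulrC.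
rewrite ler_pM// ?row_norm_coord//.
by rewrite (bigD1 j)//= lerDl sumr_ge0.
Qed.

Lemma row_norm_mulmx N M (A : 'M[R]_(N, M)) :
  exists2 c : R, 0 < c & forall v : 'rV[R]_N, `|v *m A| <= c * `|v|.
Proof.
exists (1 + \sum_i \sum_j `|A i j|) => [|v].
  by rewrite ltr_pwDl// sumr_ge0// => i _; rewrite sumr_ge0.
apply: le_trans (row_norm_mulmx_le _ _) _.
by rewrite ler_wpM2r// lerDr.
Qed.

End row_topology.

(** * Linear changes of variables *)

Lemma lebesgue_measure_affine (R : realType) (a b : R) (X : set (measurableTypeR R)) :
  a != 0 -> measurable X ->
  (lebesgue_measure X =
   `|a|%:E * lebesgue_measure ((fun t : measurableTypeR R => (a * t + b)%R) @^-1` X))%E.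
Proof.
move=> a0 mX; have mf : measurable_fun setT
    (fun t : measurableTypeR R => (a * t + b)%R : measurableTypeR R).
  by apply: measurable_funD => //; exact: measurable_funM.
pose nu : {measure set (measurableTypeR R) -> \bar R} :=
  measure_function_pushforward__canonical__measure_function_Measure lebesgue_measure mf.
pose nu' : {measure set (measurableTypeR R) -> \bar R} :=
  mscale (NngNum (normr_ge0 a)) nu.
suff nuE Y : ocitv Y -> lebesgue_measure Y = nu' Y.
  exact: (lebesgue_measure_unique nuE).
move=> [[x y] _ <-].
change (lebesgue_measure `]x, y] = `|a|%:E *
  lebesgue_measure ((fun t : measurableTypeR R => (a * t + b)%R) @^-1` `]x, y]))%E.
rewrite [in LHS]lebesgue_measure_itv/= lte_fin.
have [a_gt0|a_le0] := ltP 0 a.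
  rewrite (_ : _ @^-1` _ = `](x - b) / a, (y - b) / a]%classic); last first.
    apply/seteqP; split => t /=; rewrite !in_itv/= ltr_pdivrMr// ler_pdivlMr// (mulrC t);
      by move=> /andP[? ?]; apply/andP; split; lra.
  rewrite lebesgue_measure_itv/= lte_fin ltr_pM2r ?invr_gt0// ltrD2r.
  case: ifPn => _; last by rewrite mule0.
  by rewrite -!EFinB -EFinM gtr0_norm//; congr (_%:E); field.
have a_lt0 : a < 0 by rewrite lt_neqAle a0.
rewrite (_ : _ @^-1` _ = `[(y - b) / a, (x - b) / a[%classic); last first.
  apply/seteqP; split => t /=; rewrite !in_itv/= ler_ndivrMr// ltr_ndivlMr// (mulrC t);
    by move=> /andP[? ?]; apply/andP; split; lra.
rewrite lebesgue_measure_itv/= lte_fin ltr_nM2r ?invr_lt0// ltrD2r.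
case: ifPn => _; last by rewrite mule0.
by rewrite -!EFinB -EFinM ltr0_norm//; congr (_%:E); field.
Qed.

Section linear_change.
Context {R : realType}.
Local Open Scope ereal_scope.

Lemma ge0_integral_affine (a b : R) (f : R -> \bar R) : a != 0%R ->
  measurable_fun [set: measurableTypeR R] f -> (forall t, 0 <= f t) ->
  \int[lebesgue_measure]_t f t =
  `|a|%:E * \int[lebesgue_measure]_t f (a * t + b)%R.
Proof.
move=> a0 mf f0.
have ma : measurable_fun setT
    (fun t : measurableTypeR R => (a * t + b)%R : measurableTypeR R).
  by apply: measurable_funD => //; exact: measurable_funM.
pose nu : {measure set (measurableTypeR R) -> \bar R} :=
  measure_function_pushforward__canonical__measure_function_Measure lebesgue_measure ma.
transitivity (\int[mscale (NngNum (normr_ge0 a)) nu]_t f t).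
  by apply: eq_measure_integral => X mX _; exact: lebesgue_measure_affine.
rewrite ge0_integral_mscale//; congr (_ * _).
by rewrite ge0_integral_pushforward.
Qed.

Lemma measurable_mulmx N M (A : 'M[R]_(N, M)) :
  measurable_fun setT (fun v : 'rV[R]_N => v *m A).
Proof.
apply: measurable_fun_rowP => k.
rewrite [X in measurable_fun _ X](_ : _ =
    fun v : 'rV[R]_N => (\sum_j v ord0 j * A j k)%R).
  by apply: measurable_sum => j; apply: measurable_funM => //; exact: measurable_row_coord.
by apply/funext => v; rewrite mxE.
Qed.

Lemma measurable_addmx N (a : 'rV[R]_N) :
  measurable_fun setT (fun v : 'rV[R]_N => (v + a)%R).
Proof.
apply: measurable_fun_rowP => k.
rewrite [X in measurable_fun _ X](_ : _ = fun v : 'rV[R]_N => (v ord0 k + a ord0 k)%R).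
  by apply: measurable_funD => //; exact: measurable_row_coord.
by apply/funext => v; rewrite mxE.
Qed.

Lemma measurable_integral_row_cons N (f : 'rV[R]_N.+1 -> \bar R) :
  measurable_fun setT f -> (forall v, 0 <= f v) ->
  measurable_fun [set: measurableTypeR R]
    (fun t => \int[lebesgue_row R N]_v f (row_cons (t, v))).
Proof.
move=> mf f0; apply: (@measurable_section_integral _ _ _ _ _ (lebesgue_row R N) setT
  (f \o @row_cons R N)) => // [|p]; last exact: f0.
by apply: measurableT_comp => //; exact: measurable_row_cons.
Qed.

Lemma measurable_row_cons2 N (f : 'rV[R]_N.+1 -> \bar R) (t : R) :
  measurable_fun setT f -> measurable_fun setT (fun v : 'rV[R]_N => f (row_cons (t, v))).
Proof.
move=> mf; apply: measurableT_comp => //.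
apply: (measurableT_comp (@measurable_row_cons R N)).
exact: measurable_pair1.
Qed.

Lemma integral_translate N (a : 'rV[R]_N) (f : 'rV[R]_N -> \bar R) :
  measurable_fun setT f -> (forall v, 0 <= f v) ->
  \int[lebesgue_row R N]_v f (v + a)%R = \int[lebesgue_row R N]_v f v.
Proof.
elim: N a f => [|N IH] a f mf f0.
  by apply: eq_integral => v _; congr f; apply/rowP => -[].
have mfa : measurable_fun setT (fun v : 'rV[R]_N.+1 => f (v + a)%R).
  exact: measurableT_comp mf (measurable_addmx a).
rewrite !integral_lebesgue_rowS//.
pose g t := \int[lebesgue_row R N]_v f (row_cons (t, v)).
rewrite [RHS](@ge0_integral_affine 1 (a ord0 ord0) g) ?oner_eq0//; last 2 first.
- exact: measurable_integral_row_cons.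
- by move=> t; exact: integral_ge0.
rewrite normr1 mul1e; apply: eq_integral => t _; rewrite /g mul1r.
rewrite -[RHS](IH (\row_j a ord0 (lift ord0 j)))//; last exact: measurable_row_cons2.
apply: eq_integral => v _; congr f; apply/rowP => k.
by rewrite !mxE /=; case: unliftP => [j|] ->; rewrite ?mxE.
Qed.

(** Stated for integrands rather than sets, so that it composes along products of matrices and
    combines with Tonelli on the first coordinate. *)
Definition change_of_scale N (A : 'M[R]_N) := forall f : 'rV[R]_N -> \bar R,
  measurable_fun setT f -> (forall v, 0 <= f v) ->
  \int[lebesgue_row R N]_v f v =
  `|\det A|%:E * \int[lebesgue_row R N]_v f (v *m A).

Lemma change_of_scale_mul N (A B : 'M[R]_N) :
  change_of_scale A -> change_of_scale B -> change_of_scale (A *m B).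
Proof.
move=> hA hB f mf f0; rewrite hB// hA//; last first.
  exact: measurableT_comp mf (measurable_mulmx B).
rewrite det_mulmx normrM EFinM muleCA muleA.
by congr (_ * _); apply: eq_integral => v _; rewrite mulmxA.
Qed.

Lemma row_cons_mx N (t : R) (v : 'rV[R]_N) : row_cons (t, v) = row_mx t%:M v.
Proof.
apply/rowP => k; rewrite [LHS]mxE /= [RHS]mxE; case: splitP => j kj.
  rewrite (_ : k = ord0) ?unlift_none ?(ord1 j) ?mxE ?eqxx//.
  by apply/val_inj; rewrite /= kj (ord1 j).
by rewrite (_ : k = lift ord0 j) ?liftK//; apply/val_inj; rewrite /= kj.
Qed.

Lemma row_cons_mul_block N (t : R) (v : 'rV[R]_N) (a : 'M[R]_1) (b : 'rV[R]_N)
    (c : 'cV[R]_N) (D : 'M[R]_N) :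
  row_cons (t, v) *m block_mx a b c D =
  row_mx (t *: a + v *m c)%R (t *: b + v *m D)%R.
Proof.
rewrite row_cons_mx -[t *: a]mul_scalar_mx -[t *: b]mul_scalar_mx.
exact: (@mul_row_block R 1 1 N 1 N t%:M v a b c D).
Qed.

(** The map sends [(t, v)] to [(a t + v c, v)]: for fixed [v] it is affine in [t]. Tonelli makes the
    integral over [t] the inner one. *)
Lemma change_of_scale_lblock N (a : R) (c : 'cV[R]_N) : a != 0%R ->
  change_of_scale (block_mx a%:M 0 c 1%:M : 'M[R]_(1 + N)).
Proof.
move=> a0 f mf f0; set A := block_mx _ _ _ _.
have detA : \det A = a by rewrite det_lblock det1 mulr1 det_mx11 mxE eqxx.
have mfA : measurable_fun setT (fun v : 'rV[R]_(1 + N) => f (v *m A)).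
  exact: measurableT_comp mf (measurable_mulmx A).
rewrite detA (@integral_lebesgue_rowS R N)// (@integral_lebesgue_rowS R N)//.
have swap (g : 'rV[R]_N.+1 -> \bar R) : measurable_fun setT g -> (forall v, 0 <= g v) ->
    \int[lebesgue_measure]_t \int[lebesgue_row R N]_v g (row_cons (t, v)) =
    \int[lebesgue_row R N]_v \int[lebesgue_measure]_t g (row_cons (t, v)).
  move=> mg g0; apply: (@fubini_tonelli _ _ _ _ _ lebesgue_measure (lebesgue_row R N)
    (g \o @row_cons R N)) => // [|p]; last exact: g0.
  by apply: measurableT_comp => //; exact: measurable_row_cons.
rewrite (swap f)// (swap (fun v => f (v *m A)))// -ge0_integralZl//; last 2 first.
- apply: (@measurable_fun_fubini_tonelli_G _ _ _ _ _ lebesgue_measure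
    ((fun v : 'rV[R]_N.+1 => f (v *m A)) \o @row_cons R N)) => [|p]; last exact: f0.
  by apply: measurableT_comp => //; exact: measurable_row_cons.
- by move=> v _; exact: integral_ge0.
apply: eq_integral => v _.
rewrite (@ge0_integral_affine a ((v *m c) ord0 ord0) (fun t => f (row_cons (t, v))))//;
  last first.
  apply: measurableT_comp => //; apply: (measurableT_comp (@measurable_row_cons R N)).
  exact: measurable_pair2.
congr (_ * _); apply: eq_integral => t _; congr f.
rewrite row_cons_mul_block row_cons_mx scaler0 mulmx1 add0r; congr row_mx.
by apply/rowP => k; rewrite (ord1 k) !mxE eqxx !mulr1n mulrC.
Qed.

(** The map sends [(t, v)] to [(t, t b + v D)]: for fixed [t] it is [D] followed by a
    translation. *)
Lemma change_of_scale_ublock N (b : 'rV[R]_N) (D : 'M[R]_N) :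
  change_of_scale D -> change_of_scale (block_mx 1%:M b 0 D : 'M[R]_(1 + N)).
Proof.
move=> hD f mf f0; set A := block_mx _ _ _ _.
have detA : \det A = \det D by rewrite det_ublock det1 mul1r.
have mfA : measurable_fun setT (fun v : 'rV[R]_(1 + N) => f (v *m A)).
  exact: measurableT_comp mf (measurable_mulmx A).
rewrite detA (@integral_lebesgue_rowS R N)// (@integral_lebesgue_rowS R N)//.
rewrite -ge0_integralZl//; last 2 first.
- exact: (@measurable_integral_row_cons N (fun v => f (v *m A))).
- by move=> v _; exact: integral_ge0.
apply: eq_integral => t _.
rewrite -(integral_translate (t *: b))//; last exact: measurable_row_cons2.
rewrite hD//; last first.
  apply: (measurableT_comp (f := fun v => f (row_cons (t, v)))).
    exact: measurable_row_cons2.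
  exact: measurable_addmx.
congr (_ * _); apply: eq_integral => v _; congr f.
rewrite row_cons_mul_block row_cons_mx mulmx0 addr0 addrC; congr row_mx.
by apply/rowP => k; rewrite (ord1 k) !mxE eqxx !mulr1n mulr1.
Qed.

(* Block LU factorization and induction on the Schur complement of the top-left
   entry, which a shear makes nonzero. *)
Lemma change_of_scale_unit N (A : 'M[R]_N) : \det A != 0%R -> change_of_scale A.
Proof.
elim: N A => [|N IH] A detA.
  move=> f mf f0; rewrite det_mx00 normr1 mul1e.
  by apply: eq_integral => v _; congr f; apply/rowP => -[].
have lin1 : change_of_scale (1%:M : 'M[R]_N).
  move=> f mf f0; rewrite det1 normr1 mul1e.
  by apply: eq_integral => v _; rewrite mulmx1.
have nz (B : 'M[R]_(1 + N)) : \det B != 0%R -> B ord0 ord0 != 0%R -> change_of_scale B.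
  move=> detB B0; set a := B ord0 ord0.
  pose b := ursubmx B; pose c := dlsubmx B; pose D := drsubmx B.
  have BE : B = block_mx a%:M b c D.
    rewrite -[LHS]submxK; congr block_mx; apply/matrixP => i j.
    by rewrite (ord1 i) (ord1 j) !mxE eqxx mulr1n; congr (B _ _); apply/val_inj.
  have BPQ : B = block_mx a%:M 0 c 1%:M *m
      block_mx 1%:M (a^-1 *: b) 0 (D - a^-1 *: (c *m b)).
    rewrite mulmx_block !mul0mx !mulmx0 !mulmx1 !mul1mx !addr0 mul_scalar_mx scalerA.
    by rewrite mulfV// scale1r -scalemxAr addrC subrK.
  rewrite BPQ; apply: change_of_scale_mul; first exact: change_of_scale_lblock.
  apply: change_of_scale_ublock; apply: IH; move: detB; rewrite BPQ det_mulmx.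
  by rewrite det_ublock det1 mul1r mulf_eq0 negb_or => /andP[].
have [A0|] := eqVneq (A ord0 ord0) 0%R; last exact: nz.
have [k Ak] : exists k, A k ord0 != 0%R.
  apply: contrapT => /forallNP H; move: detA => /eqP; apply.
  rewrite (expand_det_col A ord0) big1// => k _.
  by have := H k => /negP; rewrite negbK => /eqP ->; rewrite mul0r.
have [j kj] : exists j, k = lift ord0 j.
  by case: (unliftP ord0 k) => [j ->|k0]; [exists j|rewrite k0 A0 eqxx in Ak].
(* Multiplying by [E e] adds row [k] of [A] to the top row, whose first entry becomes [A k ord0]. *)
pose e : 'rV[R]_N := delta_mx ord0 j.
pose E x : 'M[R]_(1 + N) := block_mx 1%:M x 0 1%:M.
have -> : A = E (- e)%R *m (E e *m A).
  rewrite mulmxA mulmx_block !mul0mx !mulmx0 !mulmx1 !mul1mx addr0 subrr add0r.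
  by rewrite add0r -scalar_mx_block mul1mx.
apply: change_of_scale_mul; first exact: change_of_scale_ublock.
apply: nz; first by rewrite det_mulmx det_ublock !det1 !mul1r.
have Ee i : E e ord0 (lift ord0 i) = (i == j)%:R.
  transitivity (e ord0 i); last by rewrite mxE eqxx.
  rewrite -(block_mxEur 1%:M e 0 1%:M ord0 i).
  by congr (E e _ _); exact: val_inj.
rewrite mxE big_ord_recl A0 mulr0 add0r (bigD1 j)//= Ee eqxx mul1r -kj big1 ?addr0//.
by move=> i ij; rewrite Ee (negbTE ij) mul0r.
Qed.

End linear_change.

(** * Differentiable changes of variables *)

Section rational_approximation.
Context {R : realType}.

Lemma det_continuous N : continuous (fun A : 'M[R]_N => \det A).
Proof.
apply: (@continuous_big R _ +%R 0 xpredT) => [|s _].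
  exact: add_continuous.
move=> A; apply: (@continuousM R _ (fun=> (-1) ^+ s)
  (fun A : 'M[R]_N => \prod_i A i (s i)) A); first exact: cst_continuous.
apply: (_ : continuous (fun A : 'M[R]_N => \prod_i A i (s i))).
apply: (@continuous_big R _ *%R 1 xpredT); first exact: mul_continuous.
by move=> i _; exact: coord_continuous.
Qed.

Lemma sum_dist_continuous N M (A : 'M[R]_(N, M)) :
  continuous (fun B : 'M[R]_(N, M) => \sum_i \sum_j `|(A - B) i j|).
Proof.
apply: (@continuous_big R _ +%R 0 xpredT) => [|i _]; first exact: add_continuous.
apply: (@continuous_big R _ +%R 0 xpredT) => [|j _]; first exact: add_continuous.
rewrite (_ : (fun B : 'M[R]_(N, M) => _) =
    (fun x : R => `|A i j - x|) \o (fun B : 'M[R]_(N, M) => B i j)); last first.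
  by apply/funext => B; rewrite /= !mxE.
move=> B; apply: continuous_comp; first exact: coord_continuous.
by apply: cvg_norm; apply: cvgB; [exact: cvg_cst|exact: cvg_id].
Qed.

Lemma rational_matrix_dense N M (A : 'M[R]_(N, M)) (P : 'M[R]_(N, M) -> Prop) :
  (\forall B \near A, P B) -> exists T : 'M[rat]_(N, M), P (map_mx ratr T).
Proof.
move=> /nbhs_ballP[e /= e0 AP].
have /all_sig[T HT] (ij : 'I_N * 'I_M) : {q : rat |
    ratr q \in `]A ij.1 ij.2 - e, A ij.1 ij.2 + e[}.
  by apply/cid/rat_in_itvoo; rewrite ltrBlDr -addrA ltrDl addr_gt0.
exists (\matrix_(i, j) T (i, j)); apply: AP; split=> // i j; rewrite !mxE.
by have := HT (i, j); rewrite in_itv/= /ball/= ltr_distlC.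
Qed.

(** Here [A] will be the Jacobian at a point and [u] an increment of the map. The rational [T]
    replaces [A] at the cost of a factor [L] both in the determinant and in the length of
    increments. *)
Lemma rational_distortion N (A : 'M[R]_N) (L : R) : 1 < L -> \det A != 0 ->
  exists T : 'M[rat]_N, exists2 e : R, 0 < e &
    [/\ \det (map_mx ratr T) != 0 :> R, `|\det (map_mx ratr T)| <= L * `|\det A| &
    forall u h : 'rV[R]_N, `|u - h *m A| <= e * `|h| ->
      `|u| <= L * `|h *m map_mx ratr T|].
Proof.
move=> L1 detA; have [c c0 cA] := row_norm_mulmx (invmx A).
have hA (h : 'rV[R]_N) : `|h| <= c * `|h *m A|.
  by have := cA (h *m A); rewrite mulmxK// unitmxE unitfE.
(* Then [e * |h|] is at most [(L - 1) / (L + 1)] times [|h *m A|], which gives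
   [|h *m A| <= (L + 1) / 2 * |h *m T|] and [|u| <= 2 * L / (L + 1) * |h *m A|]; the product of the
   two constants is [L]. *)
pose e := (L - 1) / (c * (L + 1)).
have L10 : 0 < L + 1 by lra.
have L00 : 0 < L - 1 by lra.
have e0 : 0 < e by rewrite divr_gt0// mulr_gt0.
have nd : 0 < (L - 1) * `|\det A| by rewrite mulr_gt0// normr_gt0.
have [T [T1 [T2 T3]]] : exists T : 'M[rat]_N,
    `|\det A - \det (map_mx ratr T)| < (L - 1) * `|\det A| /\
    (\det (map_mx ratr T) != 0 :> R /\
    \sum_i \sum_j `|(A - map_mx ratr T) i j| < e).
  apply: (@rational_matrix_dense _ _ A (fun B =>
    `|\det A - \det B| < (L - 1) * `|\det A| /\
    (\det B != 0 /\ \sum_i \sum_j `|(A - B) i j| < e))).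
  have := @det_continuous N A; move=> /cvgrPdist_lt H1.
  have := @sum_dist_continuous N N A A; move=> /cvgrPdist_lt/(_ _ e0) H2.
  have dA : 0 < `|\det A| by rewrite normr_gt0.
  near=> B; split; [|split].
  - by near: B; exact: H1.
  - have : `|\det A - \det B| < `|\det A| by near: B; exact: H1.
    by apply: contraTneq => ->; rewrite subr0 ltxx.
  - have : `|\sum_i \sum_j `|(A - A) i j| - \sum_i \sum_j `|(A - B) i j| | < e.
      by near: B; exact: H2.
    rewrite [X in `|X - _|]big1; last first.
      by move=> i _; rewrite big1// => j _; rewrite subrr mxE normr0.
    by rewrite sub0r normrN ger0_norm// sumr_ge0// => i _; rewrite sumr_ge0.
exists T, e => //; split => //.
  have := ler_normB (\det A) (\det A - \det (map_mx ratr T)).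
  by rewrite opprB addrC subrK => H; lra.
set T' := map_mx ratr T in T1 T2 T3 *.
move=> u h uh; have := hA h; set x := `|h *m A|; set y := `|h *m T'|.
have h0 : 0 <= `|h| by [].
have xy : x <= y + e * `|h|.
  have -> : x = `|h *m T' + h *m (A - T')| by rewrite -mulmxDr addrC subrK.
  apply: le_trans (ler_normD _ _) _; rewrite lerD2l.
  by apply: le_trans (row_norm_mulmx_le _ _) _; rewrite ler_wpM2r// ltW.
have ux : `|u| <= x + e * `|h|.
  have -> : u = h *m A + (u - h *m A) by rewrite addrC subrK.
  by apply: le_trans (ler_normD _ _) _; rewrite lerD2l.
move=> hx; have ce : c * e * (L + 1) = L - 1.
  by rewrite /e; field; rewrite !gt_eqF.
have ch : e * `|h| * (L + 1) <= (L - 1) * x.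
  rewrite -ce (_ : c * e * _ * _ = e * (L + 1) * (c * x)); last by ring.
  rewrite mulrAC; apply: ler_wpM2l => //.
  by rewrite ltW// mulr_gt0.
have : x * 2 <= y * (L + 1) by nra.
nra.
Unshelve. all: by end_near. Qed.

End rational_approximation.

Lemma lebesgue_row_preimage (R : realType) N (A : 'M[R]_N) (G : set 'rV[R]_N) :
  \det A != 0 -> measurable G ->
  lebesgue_row R N G =
  (`|\det A|%:E * lebesgue_row R N ((fun v => v *m A) @^-1` G))%E.
Proof.
move=> detA mG; have mGA : measurable ((fun v : 'rV[R]_N => v *m A) @^-1` G).
  by rewrite -[X in measurable X]setTI; exact: measurable_mulmx.
rewrite -[G in LHS]setIT -integral_indic// (change_of_scale_unit detA); last 2 first.
- exact/measurable_EFinP/measurable_indic.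
- by move=> v; rewrite lee_fin.
congr (_ * _)%E; rewrite -[X in lebesgue_row R N X]setIT -integral_indic//.
Qed.

(** The norm is the maximum norm, so [W] fits in the cube of side [s] based at its coordinatewise
    infima. No dimensional constant is lost, as the exact Jacobian factor requires. *)
Lemma lebesgue_row_diameter (R : realType) N (W : set 'rV[R]_N) (s : R) :
  measurable W -> 0 <= s -> (forall x y, W x -> W y -> `|y - x| <= s) ->
  (lebesgue_row R N W <= (s ^+ N)%:E)%E.
Proof.
move=> mW s0 Ws; have [->|/set0P[x0 Wx0]] := eqVneq W set0.
  by rewrite measure0 lee_fin exprn_ge0.
pose a i := inf [set x ord0 i | x in W].
have lb x i : W x -> lbound [set y ord0 i | y in W] (x ord0 i - s).
  move=> Wx _ [y Wy <-]; have := le_trans (row_norm_coord (x - y) i) (Ws _ _ Wy Wx).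
  by rewrite !mxE ler_norml => /andP[_]; lra.
pose box := [set v : 'rV[R]_N | forall i, `[a i, a i + s]%classic (v ord0 i)].
have Wbox : W `<=` box.
  move=> x Wx i; rewrite /= in_itv/=; apply/andP; split.
    apply: ge_inf; last by exists x.
    by exists (x0 ord0 i - s); exact: lb.
  rewrite -lerBlDr; apply: lb_le_inf; first by exists (x ord0 i), x.
  exact: lb.
have -> : (s ^+ N)%:E = lebesgue_row R N box.
  rewrite (lebesgue_row_box (X := fun i => `[a i, a i + s]%classic)); last first.
    by move=> i; exact: measurable_itv.
  rewrite (eq_bigr (fun=> s%:E)) ?prodEFin ?prodr_const ?card_ord// => i _.
  rewrite lebesgue_measure_itv/= lte_fin ltrDl; case: ltP => [_|s_le0].
    by rewrite -EFinB addrC addKr.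
  by congr (_%:E); apply/eqP; rewrite eq_le s0 s_le0.
rewrite le_measure ?inE//.
apply: (measurable_box (X := fun i => `[a i, a i + s]%classic)) => i.
exact: measurable_itv.
Qed.

Lemma integral_mrestr d (T : measurableType d) (R : realType)
    (mu : {measure set T -> \bar R}) (D : set T) (mD : measurable D) (f : T -> \bar R) :
  (\int[mrestr mu mD]_(x in D) f x = \int[mu]_(x in D) f x)%E.
Proof.
apply: eq_measure_integral => X mX XD.
exact: (congr1 mu (setIidl XD)).
Qed.

Section change_of_variables.
Context {R : realType} {N : nat}.
Local Notation lam := (lebesgue_row R N).
Implicit Types (A B E F : set 'rV[R]_N) (phi psi : 'rV[R]_N -> 'rV[R]_N).

(* In the coordinates [v *m T], [phi] is [L]-Lipschitz on [E] at small scale,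
   hence maps a small cell into a cube whose side is [L] times larger. *)
Lemma image_measure_le A E psi phi (T : 'M[R]_N) (L r : R)
    (mA : measurable A) (mpsi : measurable_fun setT psi) F :
  0 <= L -> 0 < r -> \det T != 0 ->
  measurable E -> (forall y, A y -> phi (psi y) = y) ->
  (forall x y, E x -> E y -> `|y - x| < r ->
     `|phi y - phi x| <= L * `|(y - x) *m T|) ->
  measurable F -> F `<=` E ->
  (lam (psi @^-1` F `&` A) <= (L ^+ N * `|\det T|)%:E * lam F)%E.
Proof.
move=> L0 r0 detT mE phiK distortion mF FE.
pose Tv (v : 'rV[R]_N) := v *m T.
have mT : measurable_fun setT Tv by exact: measurable_mulmx.
have mpre (f : 'rV[R]_N -> 'rV[R]_N) (X : set 'rV[R]_N) :
    measurable_fun setT f -> measurable X -> measurable (f @^-1` X).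
  by move=> mf mX; rewrite -[X in measurable X]setTI; exact: mf.
pose nu : {measure set 'rV[R]_N -> \bar R} :=
  measure_function_pushforward__canonical__measure_function_Measure (mrestr lam mA) mpsi.
(* [kappa X] is the volume of the points of [A] that [psi] sends into [E] with [T]-coordinates in
   [X]. As a measure in [X] it can be compared with [lamL] cube by cube. *)
pose kappa : {measure set 'rV[R]_N -> \bar R} :=
  measure_function_pushforward__canonical__measure_function_Measure (mrestr nu mE) mT.
have LN0 : 0 <= L ^+ N by rewrite exprn_ge0.
pose lamL : {measure set 'rV[R]_N -> \bar R} := mscale (NngNum LN0) lam.
have kappaE X : kappa X = lam (psi @^-1` (Tv @^-1` X `&` E) `&` A) by [].
have [c c0 cT] := row_norm_mulmx (invmx T).
have hT (h : 'rV[R]_N) : `|h| <= c * `|h *m T|.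
  by have := cT (h *m T); rewrite mulmxK// unitmxE unitfE.
(* Points of [E] whose [T]-coordinates share a cube of level at least [k0] are closer than [r], so
   the distortion bound applies. *)
have [k0 k0c] : exists k, 2 ^- k < r / c by apply: exists_expr2V_lt; rewrite divr_gt0.
pose G := (fun v => v *m invmx T) @^-1` F.
have mG : measurable G by apply: (mpre) => //; exact: measurable_mulmx.
have GF : Tv @^-1` G = F.
  by apply/funext => v; rewrite /G /Tv /= /preimage/= mulmxK// unitmxE unitfE.
have : (kappa G <= lamL G)%E.
  apply: (@measure_le_of_cells R N k0) => // [k z k0k|z]; last first.
    by rewrite /lamL /= /mscale/= lebesgue_row_cell -EFinM ltry.
  set Q := cell k @^-1` [set z]; have mQ : measurable Q by exact: measurable_cell_preimage1.
  rewrite kappaE.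
  have -> : lamL Q = ((L * 2 ^- k) ^+ N)%:E.
    by rewrite /lamL /= /mscale/= lebesgue_row_cell -EFinM exprMn.
  apply: lebesgue_row_diameter.
  - by apply: measurableI => //; apply: (mpre) => //; apply: measurableI => //; exact: mpre.
  - by rewrite mulr_ge0// invr_ge0 exprn_ge0.
  move=> x y [[Qx Ex] Ax] [[Qy Ey] Ay]; rewrite -(phiK x Ax) -(phiK y Ay).
  have d : `|(psi y - psi x) *m T| <= 2 ^- k.
    by rewrite mulmxBl; apply: cell_norm; rewrite Qx Qy.
  have kk0 : 2 ^- k <= 2 ^- k0 :> R.
    by rewrite lef_pV2 ?posrE ?exprn_gt0// ler_eXn2l// ltr1n.
  apply: le_trans (distortion _ _ Ex Ey _) _; last by rewrite ler_wpM2l.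
  apply: le_lt_trans (hT _) _; rewrite mulrC -ltr_pdivlMr//.
  exact: le_lt_trans (le_trans d kk0) k0c.
rewrite kappaE GF (setIidl FE) => /le_trans; apply.
by rewrite /lamL /= /mscale/= (lebesgue_row_preimage detT mG) -/Tv GF muleA -EFinM.
Qed.

(* The set is relatively closed in [B]. *)
Lemma distortion_set_measurable B phi (T : 'M[R]_N) (L r : R) :
  measurable B -> 0 <= L -> (forall x, B x -> {for x, continuous phi}) ->
  measurable [set x | B x /\ forall y, B y -> `|y - x| < r ->
    `|phi y - phi x| <= L * `|(y - x) *m T|].
Proof.
move=> mB L0 cphi; set E := mkset _.
rewrite (_ : E = B `&` closure E).
  apply: measurableI => //; rewrite -[X in measurable X]setCK; apply: measurableC.
  by apply: measurable_open_row; apply: closed_openC; exact: closed_closure.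
apply/seteqP; split => [x Ex|x [Bx clx]].
  by split; [case: Ex|exact: subset_closure].
split=> // y By yxr; apply/ler_addgt0Pr => e e0.
have [c c0 cT] := row_norm_mulmx T.
(* The first bound keeps [y] within [r] of the nearby point [z], the second makes the error
   [L * c * |x - z|] at most [e / 2]; the [+ 1] avoids a zero denominator. *)
pose d := Num.min (r - `|y - x|) (e / 2 / (L * c + 1)).
have Lc : 0 < L * c + 1 by rewrite ltr_wpDl// mulr_ge0// ltW.
have d0 : 0 < d by rewrite lt_min subr_gt0 yxr/= !divr_gt0.
have e20 : 0 < e / 2 by rewrite divr_gt0.
have : nbhs x [set z | `|x - z| < d /\ `|phi x - phi z| < e / 2].
  apply: (@filterI _ (nbhs x) _ [set z | `|x - z| < d]
    [set z | `|phi x - phi z| < e / 2]).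
    by have := nbhsx_ballx x d d0; rewrite -ball_normE.
  by have := cphi x Bx => /cvgrPdist_lt/(_ _ e20).
move=> /clx[z [[Bz Ez] [xz pxz]]].
have : `|y - z| < r.
  have -> : y - z = (y - x) + (x - z) by rewrite addrA subrK.
  apply: le_lt_trans (ler_normD _ _) _.
  by move: xz; rewrite lt_min => /andP[+ _]; lra.
move=> /(Ez y By) yz.
have -> : phi y - phi x = (phi y - phi z) - (phi x - phi z) by rewrite opprB addrA subrK.
apply: le_trans (ler_normB _ _) _.
have h1 : `|(y - z) *m T| <= `|(y - x) *m T| + c * `|x - z|.
  have -> : y - z = (y - x) + (x - z) by rewrite addrA subrK.
  by rewrite mulmxDl; apply: le_trans (ler_normD _ _) _; rewrite lerD2l.
have h2 : L * c * `|x - z| <= e / 2.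
  have : `|x - z| <= e / 2 / (L * c + 1) by move: xz; rewrite lt_min => /andP[_ /ltW].
  rewrite ler_pdivlMr// mulrDr mulr1 mulrC => h; apply: le_trans h.
  by rewrite lerDl.
have h3 : L * `|(y - z) *m T| <= L * `|(y - x) *m T| + L * c * `|x - z|.
  by rewrite -mulrA -mulrDr ler_wpM2l.
lra.
Qed.

(* Only the inequality is proved: applied to both directions of a change of
   variables it gives the equality, and it needs neither the chain rule for the
   two Jacobians nor a lower bound on the measure of an image. *)
Lemma change_of_variables_le A B phi psi (f1 f2 : 'rV[R]_N -> \bar R) :
  measurable A -> measurable B ->
  (forall x, B x -> A (phi x)) -> (forall y, A y -> B (psi y)) ->
  (forall x, B x -> psi (phi x) = x) -> (forall y, A y -> phi (psi y) = y) ->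
  (forall x, B x -> differentiable phi x /\ \det (jacobian phi x) != 0) ->
  (forall y, A y -> {for y, continuous psi}) ->
  measurable_fun A f1 -> measurable_fun B f2 ->
  (forall y, A y -> 0 <= f1 y)%E -> (forall x, B x -> 0 <= f2 x)%E ->
  (forall x, B x -> f2 x = `|\det (jacobian phi x)|%:E * f1 (phi x))%E ->
  (\int[lam]_(y in A) f1 y <= \int[lam]_(x in B) f2 x)%E.
Proof.
move=> mA mB BA AB phiK psiK dphi cpsi mf1 mf2 f10 f20 f12.
have cphi x : B x -> {for x, continuous phi}.
  by move=> /dphi[+ _]; exact: differentiable_continuous.
have mphi : measurable_fun B phi by exact: continuous_at_measurable.
pose psi' := psi \_ A.
have mpsi : measurable_fun setT psi'.
  by apply/(measurable_restrictT psi mA); exact: continuous_at_measurable.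
have psi'E y : A y -> psi' y = psi y by move=> Ay; rewrite /psi' patchE mem_set.
(* On sets in [B], [nu] is the volume of the image under [phi]; the aim is to bound it by the
   Jacobian times Lebesgue measure. *)
pose nu : {measure set 'rV[R]_N -> \bar R} :=
  measure_function_pushforward__canonical__measure_function_Measure (mrestr lam mA) mpsi.
pose h := (f1 \o phi) \_ B.
have mh : measurable_fun setT h.
  apply: measurable_patchT => // _ Y mY.
  have -> : B `&` (f1 \o phi) @^-1` Y = B `&` phi @^-1` (A `&` f1 @^-1` Y).
    by apply/seteqP; split => x [Bx /=]; [split=> //; split=> //; exact: BA|case].
  by apply: mphi => //; exact: mf1.
have h0 x : (0 <= h x)%E by apply: erestrict_ge0 => y /BA/f10.
have Anu : (\int[lam]_(y in A) f1 y <= \int[nu]_(x in B) h x)%E.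
  have -> : (\int[lam]_(y in A) f1 y = \int[mrestr lam mA]_(y in A) (h \o psi') y)%E.
    rewrite integral_mrestr; apply: eq_integral => y /set_mem Ay.
    by rewrite /= psi'E// /h patchE (mem_set (AB y Ay))/= psiK.
  rewrite [leRHS]ge0_integral_pushforward//; last exact: measurable_funTS.
  apply: ge0_subset_integral => //.
  - by rewrite -[X in measurable X]setTI; apply: (mpsi).
  - by apply: measurable_funTS; exact: measurableT_comp.
  - by move=> x _; exact: h0.
  - by move=> y Ay; rewrite /= psi'E//; exact: AB.
apply: le_trans Anu _; apply/lee_mul01Pr => [|r /andP[r0 r1]].
  by apply: integral_ge0 => x _; exact: h0.
(* The root is chosen so that [r * L ^+ N.+1] is 1: [N] factors [L] pay for the volume of a
   stretched cube, one for replacing the Jacobian determinant by that of [T]. *)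
pose L := expR (- ln r / N.+1%:R).
have L1 : 1 < L by rewrite expR_gt1 divr_gt0// oppr_gt0 ln_lt0// r0.
have L0 : 0 <= L by rewrite expR_ge0.
have LN : L ^+ N.+1 = r^-1.
  by rewrite -expRM_natl mulrC divfK// expRN lnK.
pose T' (q : 'M[rat]_N * nat) : 'M[R]_N := map_mx ratr q.1.
(* A piece is indexed by a rational matrix and a radius [1 / (m + 1)]. It asks for the distortion
   bound at that radius and for the determinant bound, written on integrands so that measurability
   of the Jacobian is not at stake. *)
pose piece q := [set x | B x /\ forall y, B y -> `|y - x| < q.2.+1%:R^-1 ->
    `|phi y - phi x| <= L * `|(y - x) *m T' q|] `&`
  (B `&` [set x | (`|\det (T' q)|%:E * h x <= L%:E * f2 x)%E]).
pose P k := if unpickle k is Some q then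
  if \det (T' q) == 0 then set0 else piece q else set0.
have mpiece q : measurable (piece q).
  apply: measurableI; first exact: distortion_set_measurable.
  apply: measurable_lee => //; apply: measurable_funeM => //.
  exact: measurable_funTS.
have mP k : measurable (P k).
  by rewrite /P; case: unpickle => // q; case: ifP.
have BP : B = \bigcup_k P k.
  apply/seteqP; split => [x Bx|x [k _]]; last first.
    by rewrite /P; case: unpickle => // q; case: ifP => // _ [[]].
  have [dx detx] := dphi x Bx.
  (* A point of [B] lies in the piece of a rational matrix close to its Jacobian, with a radius
     below the one where the linear approximation has error [e]. *)
  have [T [e e0 [detT detTL Te]]] := rational_distortion L1 detx.
  have [s s0 Hs] := differentiable_approx e0 dx.
  pose m := Num.bound s^-1; exists (pickle (T, m)) => //.
  rewrite /P pickleK /T'/= (negbTE detT); split; [split=> // y By yx|split=> //].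
    apply/Te/Hs; apply: lt_trans yx _; rewrite /= invf_plt ?posrE//.
    apply: lt_le_trans (_ : m%:R <= _); last by rewrite ler_nat.
    by apply: Num.Theory.archi_boundP; rewrite invr_ge0 ltW.
  rewrite /= f12// muleA -EFinM /h patchE mem_set//= lee_wpmul2r ?lee_fin//.
  exact/f10/BA.
pose D := seqDU P.
have mD k : measurable (D k) by apply: measurableD => //; exact: bigsetU_measurable.
have BD : B = \bigcup_k D k by rewrite BP seqDU_bigcup_eq.
have tD : trivIset setT D by exact: trivIset_seqDU.
have r0E : (0 <= r%:E)%E by rewrite lee_fin ltW.
rewrite -ge0_integralZl//; last exact: measurable_funTS.
have mg : measurable_fun setT (fun x => r%:E * h x)%E by exact: measurable_funeM.
have g0 x : (0 <= r%:E * h x)%E by rewrite mule_ge0.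
rewrite BD (@ge0_integral_bigcup _ _ _ nu D)//; last exact: measurable_funTS.
rewrite (@ge0_integral_bigcup _ _ _ lam D)//; last 2 first.
- by rewrite -BD.
- by rewrite -BD.
apply: lee_nneseries => [k _|k _].
  by move=> _; exact: integral_ge0.
have mDk := mD k; have DP : D k `<=` P k by move=> x [].
case Pk : (unpickle k) => [q|]; last first.
  have -> : D k = set0 by rewrite -subset0 => x /DP; rewrite /P Pk.
  by rewrite !integral_set0.
have [detT|detT] := eqVneq (\det (T' q)) 0.
  have -> : D k = set0 by rewrite -subset0 => x /DP; rewrite /P Pk detT eqxx.
  by rewrite !integral_set0.
have Dpiece : D k `<=` piece q by move=> x /DP; rewrite /P Pk (negbTE detT).
have c0 : 0 <= L ^+ N * `|\det (T' q)| by rewrite mulr_ge0// exprn_ge0.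
apply: (@le_trans _ _ (\int[mscale (NngNum c0) lam]_(x in D k) (r%:E * h x))%E).
  rewrite -(integral_mrestr nu mDk).
  apply: ge0_le_measure_integral => // X mX.
  have XD : X `&` D k `<=` D k by exact: subIsetr.
  apply: (@le_trans _ _ ((L ^+ N * `|\det (T' q)|)%:E * lam (X `&` D k))%E); last first.
    by rewrite lee_wpmul2l ?lee_fin// le_measure ?inE//; exact: measurableI.
  apply: (@image_measure_le A (piece q) psi' phi (T' q) L q.2.+1%:R^-1) => //.
  - by move=> y Ay; rewrite psi'E// psiK.
  - by move=> x y [[_ +] _] [[By _] _]; apply.
  - exact: measurableI.
  - exact: subset_trans XD Dpiece.
rewrite ge0_integral_mscale//; last exact: measurable_funTS.
rewrite -ge0_integralZl ?lee_fin//; last exact: measurable_funTS.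
have DB : D k `<=` B by move=> x /Dpiece[[]].
apply: ge0_le_integral => //.
- by move=> x _; rewrite mule_ge0 ?lee_fin.
- by apply: measurable_funTS; exact: measurable_funeM.
- exact: measurable_funS mB DB mf2.
move=> x Dx; have [_ [_ /= le_f2]] := Dpiece x Dx.
rewrite [leLHS](_ : _ = (r * L ^+ N)%:E * (`|\det (T' q)|%:E * h x))%E; last first.
  by rewrite !muleA -!EFinM; congr (_%:E * _)%E => /=; ring.
apply: (@le_trans _ _ ((r * L ^+ N)%:E * (L%:E * f2 x))%E).
  by rewrite lee_wpmul2l// lee_fin mulr_ge0 ?exprn_ge0// ltW.
rewrite muleA -EFinM -mulrA -exprSr LN divff ?mul1e//.
by rewrite gt_eqF.
Qed.

End change_of_variables.

(** * Evidence of independence-equivalent structures *)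

(** The two parameter dimensions are different sums, equal only by a proof; eliminating that proof
    turns [conform_mx] into the identity. *)
Lemma change_of_variables_conform_le (R : realType) (N1 N2 : nat) (e : N1 = N2)
    (A : set 'rV[R]_N1) (B : set 'rV[R]_N2) (phi : 'rV[R]_N2 -> 'rV[R]_N1)
    (psi : 'rV[R]_N1 -> 'rV[R]_N2) f1 f2 :
  measurable A -> measurable B ->
  (forall x, B x -> A (phi x)) -> (forall y, A y -> B (psi y)) ->
  (forall x, B x -> psi (phi x) = x) -> (forall y, A y -> phi (psi y) = y) ->
  (forall x, B x -> differentiable phi x /\
     `|\det (conform_mx (0 : 'M[R]_N1) (jacobian phi x))| != 0) ->
  (forall y, A y -> differentiable psi y) ->
  measurable_fun A f1 -> measurable_fun B f2 ->
  (forall y, A y -> 0 <= f1 y)%E -> (forall x, B x -> 0 <= f2 x)%E ->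
  (forall x, B x -> f2 x =
     `|\det (conform_mx (0 : 'M[R]_N1) (jacobian phi x))|%:E * f1 (phi x))%E ->
  (\int[lebesgue_row R N1]_(y in A) f1 y <= \int[lebesgue_row R N2]_(x in B) f2 x)%E.
Proof.
case: _ / e B phi psi f2 => B phi psi f2 mA mB BA AB phiK psiK dphi dpsi.
move=> mf1 mf2 f10 f20 f12; apply: (@change_of_variables_le _ _ A B phi psi) => //.
- by move=> x /dphi; rewrite conform_mx_id normr_eq0.
- by move=> y /dpsi; exact: differentiable_continuous.
- by move=> x /f12; rewrite conform_mx_id.
Qed.

Lemma evidence_independence_equivalent (R : realType) (n : nat) (M : bn_model R n)
    (Theta : forall S1 S2 : structure n, param M S1 -> param M S2) :
  valid_reparametrization Theta -> marginal_likelihood_equivalence Theta ->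
  forall (S1 S2 : structure n) m (D : sample M m),
  independence_equivalent R S1 S2 -> evidence M S1 D = evidence M S2 D.
Proof.
move=> reparam mle S1 S2 m D.
suff le S S' : independence_equivalent R S S' -> (evidence M S D <= evidence M S' D)%E.
  move=> eS; apply/eqP; rewrite eq_le !le//.
  by move=> A B C AB AC BC; split=> /(eS A B C AB AC BC).
move=> eS; have eS' : independence_equivalent R S' S.
  by move=> A B C AB AC BC; split=> /(eS A B C AB AC BC).
(* One instance supplies the Jacobian of [Theta S' S], the other the continuity of its inverse
   [Theta S S']. *)
have [[SS' _ _] SK _ dim dS'] := reparam S S' eS.
have [[S'S _ _] S'K lik _ dS] := reparam S' S eS'.
have mSS' := mle S S' eS.
rewrite !evidence_joint; apply: (change_of_variables_conform_le dim
  (phi := Theta S' S) (psi := Theta S S')) => //.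
- exact: measurable_param_set.
- exact: measurable_param_set.
- by move=> theta /dS[].
- apply: measurable_funTS.
  exact: (measurableT_comp (@measurable_joint_density _ _ M S m) (measurable_pair2 _)).
- apply: measurable_funTS.
  exact: (measurableT_comp (@measurable_joint_density _ _ M S' m) (measurable_pair2 _)).
- by move=> theta _; exact: joint_density_ge0.
- by move=> theta _; exact: joint_density_ge0.
(* Likelihoods are invariant under the map, and the prior of [S'] is that of [S] times the Jacobian:
   exactly the factor in the change of variables. *)
move=> theta tS'; have tS := S'S _ tS'; rewrite !joint_densityE// -EFinM.
have [_] := mSS' _ tS; rewrite S'K// => ->; congr (_%:E).
rewrite mulrCA; congr (_ * (_ * _)); apply: eq_bigr => l _.
by rewrite lik.
Qed.

Theorem theorem5 (R : realType) (n : nat) (M : bn_model R n)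
    (Theta : forall S1 S2 : structure n, param M S1 -> param M S2)
    (gpi : global_parameter_independence M)
    (lm : likelihood_modularity M)
    (pm : prior_modularity M)
    (care : covered_arc_reversal_equivalence M)
    (ident : parameter_identifiability M)
    (reparam : valid_reparametrization Theta)
    (mle : marginal_likelihood_equivalence Theta)
    (Sc : structure n) (Sc_complete : complete Sc)
    (S : structure n) (m : nat) (D : sample M m)
    (ratios_defined : forall i,
       (0 < evidence_on M Sc (S i) D < +oo)%E) :
  evidence M S D =
  (\prod_i (evidence_on M Sc (i |: S i)%SET D / evidence_on M Sc (S i) D))%E.
Proof.
apply: evidence_quotient => // S1 S2 D' cS1 cS2.
exact: (evidence_independence_equivalent reparam mle)
  (complete_independence_equivalent R cS1 cS2).
Qed.
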